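(* Let $\mathcal{A}$ be a separable commutative unital $C^*$-algebra with uncountable spectrum and let $\mathcal{H}$ be an infinite dimensional separable complex Hilbert space. Then $UCP_{\mathcal{H}}(\mathcal{A})$ contains a $C^*$-extreme point which is not a $*$-homomorphism.
   Context: The spectrum of a commutative unital $C^*$-algebra $\mathcal{A}$ is the compact Hausdorff space $X$ (unique up to homeomorphism) with $\mathcal{A}\cong C(X)$. $\mathcal{B}(\mathcal{H})$ denotes the bounded operators on $\mathcal{H}$, and $UCP_{\mathcal{H}}(\mathcal{A})$ is the set of all unital completely positive linear maps $\mathcal{A}\to\mathcal{B}(\mathcal{H})$. A map $\phi\in UCP_{\mathcal{H}}(\mathcal{A})$ is a $C^*$-extreme point of $UCP_{\mathcal{H}}(\mathcal{A})$ if, whenever $\phi=\sum_{i=1}^n T_i^*\phi_i(\cdot)T_i$ with $\phi_i\in UCP_{\mathcal{H}}(\mathcal{A})$ and invertible $T_i\in\mathcal{B}(\mathcal{H})$ satisfying $\sum_{i=1}^n T_i^*T_i=I_{\mathcal{H}}$, then for every $i$ there is a unitary $U_i\in\mathcal{B}(\mathcal{H})$ with $\phi=U_i^*\phi_i(\cdot)U_i$. *)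

(* Defs.v *)
From HB Require Import structures.
From mathcomp Require Import all_boot all_order all_algebra.
From mathcomp Require Import all_classical all_reals all_analysis.
From mathcomp Require Import complex.

Set Implicit Arguments.
Unset Strict Implicit.
Unset Printing Implicit Defensive.

Import Order.TTheory GRing.Theory Num.Theory.
Import numFieldNormedType.Exports.

Local Open Scope classical_set_scope.
Local Open Scope complex_scope.
Local Open Scope ring_scope.

(* Norms of modules over R[i] take their values in R[i]; the order of R[i] is
   the partial one, so that [0 <= z] says that z is real and nonnegative. *)

(* The algebra operations are fields here, because a type that is both a
   GRing.PzRing and a normed module over another ring would need joins below
   Num.NumDomain that the hierarchy does not have. *)
HB.mixin Record CompleteNormedModule_isCStarAlgebra (R : realType) (A : Type)
    & CompleteNormedModule R[i] A := {
  cone : A;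
  cmul : A -> A -> A;
  cstar : A -> A;
  cmulA : associative cmul;
  cmul1a : left_id cone cmul;
  cmula1 : right_id cone cmul;
  cmulDl : left_distributive cmul +%R;
  cmulDr : right_distributive cmul +%R;
  cmulZl : forall (c : R[i]) (a b : A), cmul (c *: a) b = c *: cmul a b;
  cmulZr : forall (c : R[i]) (a b : A), cmul a (c *: b) = c *: cmul a b;
  cstarK : involutive cstar;
  cstarD : {morph cstar : a b / a + b};
  cstarZ : forall (c : R[i]) (a : A), cstar (c *: a) = c^* *: cstar a;
  cstarM : forall a b : A, cstar (cmul a b) = cmul (cstar b) (cstar a);
  cnormM : forall a b : A, `|cmul a b| <= `|a| * `|b|;
  cstar_norm : forall a : A, `|cmul (cstar a) a| = `|a| ^+ 2
}.

#[short(type="cstarAlgType")]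
HB.structure Definition CStarAlgebra (R : realType) :=
  {A of CompleteNormedModule R[i] A & CompleteNormedModule_isCStarAlgebra R A}.

Notation "a *c b" := (cmul a b) (at level 40, left associativity) : ring_scope.

(* The inner product is linear in the first argument and conjugate-linear in
   the second one. *)
HB.mixin Record CompleteNormedModule_isHilbert (R : realType) (H : Type)
    & CompleteNormedModule R[i] H := {
  inner : {dot H for Num.conj};
  inner_normE : forall x : H, `|x| ^+ 2 = inner x x
}.

#[short(type="hilbertType")]
HB.structure Definition Hilbert (R : realType) :=
  {H of CompleteNormedModule R[i] H & CompleteNormedModule_isHilbert R H}.

Definition separable (T : topologicalType) : Prop :=
  exists2 D : set T, countable D & dense D.

Definition finite_dimensional (K : nzRingType) (V : lmodType K) : Prop :=
  exists n (e : 'I_n -> V), forall x : V,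
    exists c : 'I_n -> K, x = \sum_(i < n) c i *: e i.

Section BoundedOperators.
Context {R : realType} {H : hilbertType R}.

Record boundedOp := BoundedOp {
  bop_fun :> {linear H -> H};
  bop_bounded : bounded_near bop_fun (nbhs (0 : H))
}.

HB.instance Definition _ := gen_eqMixin boundedOp.
HB.instance Definition _ := gen_choiceMixin boundedOp.

Lemma bounded_near_id : bounded_near (@idfun H) (nbhs (0 : H)).
Proof. by apply: (@continuous_linear_bounded _ _ _ 0 idfun); exact: cvg_id. Qed.

Definition idOp : boundedOp := BoundedOp bounded_near_id.

(* The adjoint exists and is unique by the Riesz representation theorem;
   [idOp] is only the default value that [xget] asks for. *)
Definition adjoint (T : boundedOp) : boundedOp :=
  xget idOp [set S : boundedOp | forall x y : H, inner (T x) y = inner x (S y)].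

Definition invertible_op (T : boundedOp) : Prop :=
  exists S : boundedOp, cancel T S /\ cancel S T.

Definition unitary_op (U : boundedOp) : Prop :=
  cancel U (adjoint U) /\ cancel (adjoint U) U.

End BoundedOperators.
Arguments boundedOp {R} H.

Section UCP.
Context {R : realType} {A : cstarAlgType R} {H : hilbertType R}.
Implicit Type phi : A -> boundedOp H.

(* Positivity in M_n(A): a = b^* b for some b in M_n(A). *)
Definition positive_mx n (a : 'M[A]_n) : Prop :=
  exists b : 'M[A]_n, forall i j, a i j = \sum_(k < n) cstar (b k i) *c b k j.

(* Positivity in M_n(B(H)) = B(H^n). *)
Definition positive_op_mx n (T : 'I_n -> 'I_n -> boundedOp H) : Prop :=
  forall x : 'I_n -> H, 0 <= \sum_(i < n) \sum_(j < n) inner (T i j (x j)) (x i).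

Definition linear_map phi : Prop :=
  forall (c : R[i]) (a b : A) (x : H), phi (c *: a + b) x = c *: phi a x + phi b x.

Definition unital_map phi : Prop := forall x : H, phi cone x = x.

Definition completely_positive phi : Prop :=
  forall n (a : 'M[A]_n),
    positive_mx a -> positive_op_mx (fun i j => phi (a i j)).

Definition ucp : set (A -> boundedOp H) :=
  [set phi | [/\ linear_map phi, unital_map phi & completely_positive phi]].

Definition cstar_extreme phi : Prop :=
  ucp phi /\
  forall n (psi : 'I_n -> A -> boundedOp H) (T : 'I_n -> boundedOp H),
    (forall i, ucp (psi i)) ->
    (forall i, invertible_op (T i)) ->
    (forall x : H, \sum_(i < n) adjoint (T i) (T i x) = x) ->
    (forall (a : A) (x : H),
       phi a x = \sum_(i < n) adjoint (T i) (psi i a (T i x))) ->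
    forall i, exists2 U : boundedOp H, unitary_op U &
      forall (a : A) (x : H), phi a x = adjoint U (psi i a (U x)).

Definition star_homomorphism phi : Prop :=
  [/\ linear_map phi,
      forall (a b : A) (x : H), phi (a *c b) x = phi a (phi b x) &
      forall (a : A) (x : H), phi (cstar a) x = adjoint (phi a) x].

End UCP.

(* X is the spectrum of A when it is compact Hausdorff and A is *-isomorphic to
   C(X); the *-isomorphism is given as a map G from A to the functions on X
   that is injective and has the continuous functions as its range.  [^o] is
   there to select the norm topology of R[i]. *)
Definition is_spectrum (R : realType) (A : cstarAlgType R)
    (X : topologicalType) : Prop :=
  [/\ compact [set: X], hausdorff_space X &
  exists G : A -> X -> R[i]^o,
    [/\ injective G /\ range G = [set f | continuous f],
        forall (c : R[i]) (a b : A) (x : X), G (c *: a + b) x = c * G a x + G b x,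
        forall (a b : A) (x : X), G (a *c b) x = G a x * G b x,
        forall x : X, G cone x = 1 &
        forall (a : A) (x : X), G (cstar a) x = (G a x : R[i])^*]].

(* Main.v *)
From HB Require Import structures.
Require Import Defs.
From mathcomp Require Import all_boot all_order all_algebra.
From mathcomp Require Import all_classical all_reals all_analysis.
From mathcomp Require Import complex.
From mathcomp Require Import ring lra.

(** The model is the Toeplitz map on the Hardy space.  Multiplication by
    continuous functions on the circle, compressed to the Hardy space, is a
    unital completely positive map that is not multiplicative.  It is
    C*-extreme because a bounded, boundedly invertible density on the circle is
    the squared modulus of an invertible analytic function.

    The spectrum X of A sees the circle as follows.  As A is separable, X is
    metrizable, and being uncountable it contains a Cantor set (lemma
    [cantor_scheme]).  Reading the points of the Cantor set as binary expansions
    of angles gives a unitary w in A, and giving all digits independent fair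
    weights gives a state m of A, for which w has the distribution of Haar
    measure: m (w^n) = 0 for n > 0.  An angle determines its digits almost
    everywhere, so every element of A is a bounded mean-square limit of
    trigonometric polynomials in w.  The record [haar_functional] states these
    properties, and [haar_functional_of_sampling] proves them.

    Let e be an orthonormal basis of H.  The Toeplitz map phi is given by
    < phi(a) e_i, e_j > = m ((w^* )^j a w^i).  It sends w to the unilateral shift
    S and w^* to an operator that kills e_0, which rules out multiplicativity
    since w w^* = 1.

    For C*-extremality let phi be the sum of the T_i^* psi_i(.) T_i, fix one
    index, and write psi and T for its two terms; then theta = T^* psi(.) T is
    dominated by phi as a completely positive map.  The formal vector
    (w, x) - (1, S x) has length 0 for the Stinespring form of phi, hence also
    for that of theta, and Cauchy-Schwarz gives theta(a w) = theta(a) S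
    ([dominated_absorb]).  So T S T^-1 is an isometry.  Being similar to S it is
    pure and its range has codimension one, so by Wold's argument the images of
    a unit wandering vector form an orthonormal basis, and the unitary U that
    maps e to this basis satisfies U S = T S T^-1 U ([wandering_unitary]).
    Consequently phi and U^* psi(.) U agree on trigonometric polynomials in w.
    Both are controlled by phi, so they agree on all of A by density
    ([dominated_unitary_equiv]).  The wandering vector takes the place of the
    analytic factor of the density: this is the Hilbert space proof of Szego's
    factorization theorem. *)

Set Implicit Arguments.
Unset Strict Implicit.
Unset Printing Implicit Defensive.
Import Order.TTheory GRing.Theory Num.Theory.
Import numFieldNormedType.Exports.
Local Open Scope classical_set_scope.
Local Open Scope complex_scope.
Local Open Scope ring_scope.
Local Notation Re := complex.Re.
Local Notation Im := complex.Im.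

(** * Real-valued norms and convergence of sequences *)
Section RealNorm.
Context {R : realType}.
Implicit Types z t : R[i].

(** Norms here take values in the partially ordered field [R[i]]; their real parts
    live in a totally ordered field, where inequalities can be combined. *)
Definition nm {V : normedZmodType R[i]} (x : V) : R := Re `|x|.

Lemma nmE (V : normedZmodType R[i]) (x : V) : `|x| = (nm x)%:C.
Proof. by rewrite /nm RRe_real ?normr_real. Qed.

Lemma nm_ge0 (V : normedZmodType R[i]) (x : V) : 0 <= nm x.
Proof. by rewrite -lecR -nmE; exact: normr_ge0. Qed.

Lemma nmD (V : normedZmodType R[i]) (x y : V) : nm (x + y) <= nm x + nm y.
Proof. by rewrite -lecR rmorphD /= -!nmE ler_normD. Qed.

Lemma nmN (V : normedZmodType R[i]) (x : V) : nm (- x) = nm x.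
Proof. by rewrite /nm normrN. Qed.

Lemma nmC (V : normedZmodType R[i]) (x y : V) : nm (x - y) = nm (y - x).
Proof. by rewrite -nmN opprB. Qed.

Lemma nm0 (V : normedZmodType R[i]) : nm (0 : V) = 0.
Proof. by rewrite /nm normr0. Qed.

Lemma nm_eq0 (V : normedZmodType R[i]) (x : V) : nm x = 0 -> x = 0.
Proof. by move=> x0; apply/normr0_eq0; rewrite nmE x0. Qed.

Lemma nmBD (V : normedZmodType R[i]) (x y z : V) :
  nm (x - z) <= nm (x - y) + nm (y - z).
Proof. by rewrite -[x - z](subrKA y) nmD. Qed.

Lemma nmZ (V : normedModType R[i]) z (x : V) : nm (z *: x) = nm z * nm x.
Proof. by apply: complexI; rewrite rmorphM /= -!nmE normrZ. Qed.

Lemma nmM z t : nm (z * t) = nm z * nm t.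
Proof. by apply: complexI; rewrite rmorphM /= -!nmE normrM. Qed.

Lemma nm1 : nm (1 : R[i]) = 1.
Proof. by rewrite /nm normr1. Qed.

Lemma nmJ z : nm (z^*) = nm z.
Proof. by rewrite /nm normcJ. Qed.

Lemma nm_real (x : R) : nm (x%:C) = `|x|.
Proof. by rewrite /nm normc_def/= expr0n/= addr0 sqrtr_sqr. Qed.

Lemma nmX z n : nm (z ^+ n) = nm z ^+ n.
Proof. by elim: n => [|n IH]; rewrite ?expr0 ?nm1 // !exprS nmM IH. Qed.

Lemma nm_sqr z : nm z ^+ 2 = Re z ^+ 2 + Im z ^+ 2.
Proof. by apply: complexI; rewrite add_Re2_Im2 rmorphXn/= -nmE. Qed.

Lemma mulCJ z : z * z^* = (nm z ^+ 2)%:C.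
Proof. by rewrite -sqr_normc nmE rmorphXn. Qed.

Lemma normRe_le z : `|Re z| <= nm z.
Proof. by rewrite -lecR -nmE; exact: normc_ge_Re. Qed.

Lemma Re_le z : Re z <= nm z.
Proof. exact: le_trans (ler_norm _) (normRe_le _). Qed.

Lemma ReM_real (x : R) z : Re (x%:C * z) = x * Re z.
Proof. by case: z => a b /=; rewrite mul0r subr0. Qed.

Lemma ReD z t : Re (z + t) = Re z + Re t. Proof. exact: raddfD. Qed.
Lemma ReN z : Re (- z) = - Re z. Proof. exact: raddfN. Qed.
Lemma ReB z t : Re (z - t) = Re z - Re t. Proof. exact: raddfB. Qed.
Lemma ImD z t : Im (z + t) = Im z + Im t. Proof. exact: raddfD. Qed.
Lemma ReJ z : Re (z^*) = Re z. Proof. by case: z. Qed.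
Lemma ge0_Re z : 0 <= z -> 0 <= Re z.
Proof. by rewrite lecE => /andP[_]. Qed.
Lemma ge0_real z : 0 <= z -> z = (Re z)%:C.
Proof. by move=> z0; rewrite RRe_real// ger0_real. Qed.

Lemma real_lt_square (V : normedZmodType R[i]) (x : V) (e : R) :
  0 < e -> nm x ^+ 2 < e ^+ 2 -> nm x < e.
Proof. by move=> e0; rewrite ltr_sqr// ?nnegrE ?nm_ge0 ?ltW. Qed.

(** The core of every Cauchy-Schwarz inequality below: [t] runs over the real
    multiples of the conjugate of [z], which leaves a real quadratic polynomial
    that keeps its sign. *)
Lemma quadratic_disc (a b : R) z : 0 <= b ->
  (forall t, 0 <= a + 2 * Re (t * z) + nm t ^+ 2 * b) -> nm z ^+ 2 <= a * b.
Proof.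
move=> b0 h; set c := nm z ^+ 2; have c0 : 0 <= c by exact: sqr_ge0.
have {}h (s : R) : 0 <= a - 2 * s * c + s ^+ 2 * c * b.
  have := h ((- s)%:C * z^*).
  rewrite -mulrA [_^* * _]mulrC mulCJ -rmorphM/= nmM nmJ nm_real exprMn.
  by rewrite real_normK ?num_real// sqrrN -/c; congr (0 <= _); ring.
have [->|cn0] := eqVneq c 0.
  by rewrite mulr_ge0//; have := h 0; lra.
have {cn0}c0 : 0 < c by rewrite lt0r cn0.
move: b0; rewrite le_eqVlt => /orP[/eqP b0|b0].
  have := h ((a + 1) / (2 * c)); rewrite -b0 !mulr0 addr0.
  have -> : 2 * ((a + 1) / (2 * c)) * c = a + 1 by field; lra.
  lra.
(* the minimum of the polynomial in [s] *)
have := h b^-1.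
have -> : a - 2 / b * c + b^-1 ^+ 2 * c * b = (a * b - c) / b by field; lra.
by rewrite pmulr_lge0 ?invr_gt0// subr_ge0.
Qed.

Section Sequences.
Variable V : normedZmodType R[i].

Definition tends (u : nat -> V) (l : V) : Prop :=
  forall e : R, 0 < e -> exists n0, forall n, (n0 <= n)%N -> nm (u n - l) < e.

Lemma tends_unique u l l' : tends u l -> tends u l' -> l = l'.
Proof.
move=> ul ul'; apply/eqP; rewrite -subr_eq0; apply/eqP/nm_eq0/eqP.
rewrite eq_le nm_ge0 andbT; apply/ler_addgt0Pr => e e0; rewrite add0r.
have [n1 h1] := ul (e / 2) ltac:(lra); have [n2 h2] := ul' (e / 2) ltac:(lra).
have := h1 _ (leq_maxl n1 n2); have := h2 _ (leq_maxr n1 n2).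
have := nmBD l (u (maxn n1 n2)) l'; rewrite [nm (l - u _)]nmC; lra.
Qed.

Lemma tends_cst l : tends (fun=> l) l.
Proof. by move=> e e0; exists 0%N => n _; rewrite subrr nm0. Qed.

Lemma tendsD u v l l' : tends u l -> tends v l' -> tends (fun n => u n + v n) (l + l').
Proof.
move=> ul vl' e e0.
have [n1 h1] := ul (e / 2) ltac:(lra); have [n2 h2] := vl' (e / 2) ltac:(lra).
exists (maxn n1 n2) => n; rewrite geq_max => /andP[/h1 {}h1 /h2 {}h2].
rewrite opprD addrACA; have := nmD (u n - l) (v n - l'); lra.
Qed.

Lemma tends_le u l (B : R) : tends u l -> (forall n, nm (u n) <= B) -> nm l <= B.
Proof.
move=> ul uB; apply/ler_addgt0Pr => e e0; have [n h] := ul e e0.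
have := h n (leqnn n); have := uB n; have := nmD (l - u n) (u n).
rewrite subrK nmC; lra.
Qed.

End Sequences.

Lemma tends_comp (V W : normedZmodType R[i]) (f : V -> W) (K : R) u l :
    (forall x y, nm (f x - f y) <= K * nm (x - y)) ->
  tends u l -> tends (f \o u) (f l).
Proof.
move=> fK ul e e0; have k0 : 0 < `|K| + 1 by have := normr_ge0 K; lra.
have [n0 h] := ul (e / (`|K| + 1)) ltac:(exact: divr_gt0).
exists n0 => n /h; rewrite ltr_pdivlMr// => {}h.
apply: le_lt_trans (fK _ _) _; apply: le_lt_trans _ h; rewrite mulrC.
by apply: ler_wpM2l; [exact: nm_ge0|have := ler_norm K; lra].
Qed.

Lemma tends_complete (V : completeNormedModType R[i]) (u : nat -> V) :
    (forall e : R, 0 < e ->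
       exists n0, forall m n, (n0 <= m)%N -> (n0 <= n)%N -> nm (u m - u n) < e) ->
  exists l, tends u l.
Proof.
move=> cu; have /cvg_ex[l ul] : cvg (u @ \oo).
  apply: cauchy_cvg; apply/cauchy_exP => e e0.
  have er : e = (Re e)%:C by apply: ge0_real; exact: ltW.
  have [|n0 h] := cu (Re e); first by rewrite -ltcR -er.
  exists (u n0); exists n0 => // n/= n0n.
  rewrite -ball_normE/= nmE er ltcR; exact: h.
exists l => e e0; have /cvgrPdist_lt/(_ e%:C) := ul; rewrite ltcR => /(_ e0).
by case=> n0 _ h; exists n0 => n n0n; rewrite nmC -ltcR -nmE; exact: h.
Qed.

Lemma separable_dense_seq (V : normedModType R[i]) : separable V ->
  exists d : nat -> V, forall x (e : R), 0 < e -> exists k, nm (x - d k) < e.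
Proof.
case=> D cD dD; have near x (e : R) : 0 < e -> exists2 y, D y & nm (x - y) < e.
  move=> e0; have e0' : 0 < e%:C :> R[i] by rewrite ltcR.
  have [|y [xy Dy]] := dD (ball x e%:C) _ (@ball_open _ _ x e%:C).
    by exists x; exact: ballxx.
  by exists y => //; move: xy; rewrite -ball_normE/= nmE ltcR.
have [y0 Dy0 _] := near 0 1 ltr01.
have /pfcard_geP[D0|[f]] := cD; first by rewrite D0 in Dy0.
exists f => x e e0; have [y Dy xy] := near x e e0.
by have [k _ fk] := 'surj_f Dy; exists k; rewrite fk.
Qed.
End RealNorm.

(** * Bounded operators and orthonormal bases *)
Section HilbertSpace.
Context {R : realType} {H : hilbertType R}.
Implicit Types (x y : H) (c : nat -> R[i]) (T : boundedOp H).

Lemma innerC x y : inner y x = (inner x y)^*.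
Proof. by rewrite hermC/= expr0 mul1r. Qed.

Lemma innerDl x y z : inner (x + y) z = inner x z + inner y z.
Proof. exact: linearDl. Qed.
Lemma innerDr x y z : inner z (x + y) = inner z x + inner z y.
Proof. exact: linearDr. Qed.
Lemma innerBl x y z : inner (x - y) z = inner x z - inner y z.
Proof. exact: linearBl. Qed.
Lemma innerBr x y z : inner z (x - y) = inner z x - inner z y.
Proof. exact: linearBr. Qed.
Lemma innerZl (a : R[i]) x y : inner (a *: x) y = a * inner x y.
Proof. by rewrite linearZl_LR. Qed.
Lemma innerZr (a : R[i]) x y : inner x (a *: y) = a^* * inner x y.
Proof. by rewrite linearZr_LR. Qed.
Lemma innerNl x y : inner (- x) y = - inner x y. Proof. exact: linearNl. Qed.
Lemma innerNr x y : inner x (- y) = - inner x y. Proof. exact: linearNr. Qed.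
Lemma inner0l y : inner (0 : H) y = 0. Proof. exact: linear0l. Qed.
Lemma inner0r y : inner y (0 : H) = 0. Proof. exact: linear0r. Qed.
Lemma inner_suml n (f : 'I_n -> H) y :
  inner (\sum_(i < n) f i) y = \sum_(i < n) inner (f i) y.
Proof. exact: linear_sumlz. Qed.
Lemma inner_sumr n (f : 'I_n -> H) y :
  inner y (\sum_(i < n) f i) = \sum_(i < n) inner y (f i).
Proof. exact: linear_sumr. Qed.

Lemma inner_nm x : inner x x = (nm x ^+ 2)%:C.
Proof. by rewrite -inner_normE nmE rmorphXn. Qed.

Lemma nm2E x : nm x ^+ 2 = Re (inner x x).
Proof. by rewrite inner_nm. Qed.

Lemma nm_sqrD x y : nm (x + y) ^+ 2 = nm x ^+ 2 + 2 * Re (inner x y) + nm y ^+ 2.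
Proof. by rewrite !nm2E innerDl !innerDr (innerC x y) !ReD ReJ; ring. Qed.

Lemma inner_eq x y : (forall z, inner x z = inner y z) -> x = y.
Proof.
move=> h; apply/eqP; rewrite -subr_eq0; apply/eqP/nm_eq0/eqP.
by rewrite -(sqrf_eq0 (nm _)); apply/eqP/complexI; rewrite -inner_nm innerBl h subrr.
Qed.

Lemma inner_eqr x y : (forall z, inner z x = inner z y) -> x = y.
Proof. by move=> h; apply: inner_eq => z; rewrite (innerC z x) h -innerC. Qed.

Lemma cauchy_schwarz x y : nm (inner x y) <= nm x * nm y.
Proof.
rewrite -(@ler_pXn2r _ 2)// ?nnegrE ?mulr_ge0 ?nm_ge0// exprMn mulrC.
apply: quadratic_disc => [|t]; first exact: sqr_ge0.
by have := sqr_ge0 (nm (y + t *: x)); rewrite nm_sqrD innerZr nmZ exprMn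
  (innerC x y) -rmorphM ReJ.
Qed.

Lemma tends_innerl (u : nat -> H) x y :
  tends u x -> tends (fun n => inner (u n) y) (inner x y).
Proof.
apply: (@tends_comp _ _ _ (fun z => inner z y) (nm y)) => a b.
by rewrite -innerBl mulrC; exact: cauchy_schwarz.
Qed.

Lemma opD T x y : T (x + y) = T x + T y. Proof. exact: linearD. Qed.
Lemma opB T x y : T (x - y) = T x - T y. Proof. exact: linearB. Qed.
Lemma opZ T (a : R[i]) x : T (a *: x) = a *: T x. Proof. exact: linearZ. Qed.
Lemma opN T x : T (- x) = - T x. Proof. exact: linearN. Qed.
Lemma op0 T : T 0 = 0. Proof. exact: linear0. Qed.

Lemma op_sum T n (f : 'I_n -> H) : T (\sum_(i < n) f i) = \sum_(i < n) T (f i).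
Proof. exact: linear_sum. Qed.

Lemma op_bound T : exists2 K : R, 0 < K & forall x, nm (T x) <= K * nm x.
Proof.
have /linear_boundedP/pinfty_ex_gt0[k k0 Tk] := @bop_bounded _ _ T.
have kr : k = (Re k)%:C by apply: ge0_real; exact: ltW.
exists (Re k) => [|x]; first by rewrite -ltcR -kr.
by rewrite -lecR rmorphM/= -kr -!nmE.
Qed.

Lemma exists_op (f : H -> H) (K : R) :
    (forall (a : R[i]) x y, f (a *: x + y) = a *: f x + f y) ->
    (forall x, nm (f x) <= K * nm x) ->
  exists T : boundedOp H, forall x, T x = f x.
Proof.
move=> flin fK.
pose F : {linear H -> H} := HB.pack f (GRing.isLinear.Build _ _ _ _ f flin).
suff bF : bounded_near F (nbhs (0 : H)) by exists (BoundedOp bF).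
apply/linear_boundedP; near=> r => x.
have rr : K%:C <= r by near: r; apply: nbhs_pinfty_ge; apply/complex_realP; exists K.
apply: le_trans (ler_wpM2r _ rr) => //.
by rewrite !nmE -rmorphM/= lecR; exact: fK.
Unshelve. all: by end_near. Qed.

Lemma tends_op T (u : nat -> H) x : tends u x -> tends (fun n => T (u n)) (T x).
Proof.
have [K _ TK] := op_bound T; apply: (@tends_comp _ _ _ T K) => a b.
by rewrite -opB.
Qed.

Lemma orthonormal_lincomb (f : nat -> H) :
    (forall i j, inner (f i) (f j) = (i == j)%:R) ->
  forall c (d : nat -> R[i]) n, inner (\sum_(i < n) c i *: f i) (\sum_(i < n) d i *: f i) =
    \sum_(i < n) c i * (d i)^*.
Proof.
move=> fo c d n; rewrite inner_suml; apply: eq_bigr => i _.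
rewrite inner_sumr (bigD1 i)//= innerZl innerZr fo eqxx mulr1.
rewrite big1 ?addr0 // => j ji; rewrite innerZl innerZr fo.
by rewrite (_ : _ == _ = false) ?mulr0//; apply: contra_neqF ji => /eqP/val_inj.
Qed.

Lemma orthonormal_nm (f : nat -> H) :
    (forall i j, inner (f i) (f j) = (i == j)%:R) ->
  forall c n, nm (\sum_(i < n) c i *: f i) ^+ 2 = \sum_(i < n) nm (c i) ^+ 2.
Proof.
move=> fo c n; apply: complexI; rewrite -inner_nm orthonormal_lincomb//.
by rewrite rmorph_sum; apply: eq_bigr => i _; rewrite /= mulCJ.
Qed.

Lemma bounded_sum_cauchy (a : nat -> R) (B : R) :
    (forall i, 0 <= a i) -> (forall n, \sum_(i < n) a i <= B) ->
  forall e : R, 0 < e -> exists n0, forall n, (n0 <= n)%N ->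
    \sum_(i < n) a i - \sum_(i < n0) a i < e.
Proof.
move=> a0 aB e e0; pose S n := \sum_(i < n) a i.
have hS : has_sup (range S).
  by split; [exists (S 0%N); exists 0%N|exists B => _ [n _ <-]; exact: aB].
have [_ [n0 _ <-] h] := sup_adherent e0 hS.
exists n0 => n _; have : S n <= sup (range S).
  by apply: ub_le_sup; [case: hS|exists n].
rewrite /S in h *; lra.
Qed.

Lemma sum_tail (V : zmodType) (F : nat -> V) n0 n : (n0 <= n)%N ->
  \sum_(i < n) F i - \sum_(i < n0) F i =
  \sum_(i < n) if (i < n0)%N then 0 else F i.
Proof.
move=> n0n; rewrite (big_ord_widen _ F n0n) [X in _ - X]big_mkcond -sumrB.
by apply: eq_bigr => i _; case: ifP => _; rewrite ?subrr ?subr0.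
Qed.

(** The Bessel-type bound makes the tails of the series as small as the tails of
    the sum of the squared coefficients. *)
Lemma lincomb_tends (v : nat -> H) (K B : R) c :
    (forall c n, nm (\sum_(i < n) c i *: v i) ^+ 2 <= K * \sum_(i < n) nm (c i) ^+ 2) ->
    (forall n, \sum_(i < n) nm (c i) ^+ 2 <= B) ->
  exists l, tends (fun n => \sum_(i < n) c i *: v i) l.
Proof.
move=> vK cB; apply: tends_complete => e e0.
have k0 : 0 < `|K| + 1 by have := normr_ge0 K; lra.
have e20 : 0 < (e / 2) ^+ 2 / (`|K| + 1) by apply: divr_gt0 => //; apply: exprn_gt0; lra.
have [n0 h] := bounded_sum_cauchy (fun i => sqr_ge0 (nm (c i))) cB e20.
have half n : (n0 <= n)%N ->
    nm (\sum_(i < n) c i *: v i - \sum_(i < n0) c i *: v i) < e / 2.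
  move=> n0n; pose c' i := if (i < n0)%N then 0 else c i.
  have -> : \sum_(i < n) c i *: v i - \sum_(i < n0) c i *: v i =
            \sum_(i < n) c' i *: v i.
    rewrite (sum_tail (fun i => c i *: v i))//; apply: eq_bigr => i _.
    by rewrite /c'; case: ifP; rewrite ?scale0r.
  have h' : \sum_(i < n) nm (c' i) ^+ 2 =
            \sum_(i < n) nm (c i) ^+ 2 - \sum_(i < n0) nm (c i) ^+ 2.
    rewrite (sum_tail (fun i => nm (c i) ^+ 2))//; apply: eq_bigr => i _.
    by rewrite /c'; case: ifP; rewrite ?nm0 ?expr0n.
  apply: real_lt_square; first lra.
  apply: le_lt_trans (vK _ _) _; rewrite h'.
  have := h n n0n; rewrite ltr_pdivlMr// => {}h.
  apply: le_lt_trans _ h; rewrite mulrC; apply: ler_wpM2l.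
    by rewrite -h'; apply: sumr_ge0 => i _; exact: sqr_ge0.
  by have := ler_norm K; lra.
exists n0 => m n /half + /half; set a := \sum_(i < n0) _.
have := nmBD (\sum_(i < m) c i *: v i) a (\sum_(i < n) c i *: v i).
rewrite [nm (a - _)]nmC; lra.
Qed.

Definition orthonormal_basis (e : nat -> H) : Prop :=
  (forall i j, inner (e i) (e j) = (i == j)%:R) /\
  (forall x, (forall i, inner x (e i) = 0) -> x = 0).

End HilbertSpace.

Section Basis.
Context {R : realType} {H : hilbertType R}.
Variable e : nat -> H.
Hypothesis e_onb : orthonormal_basis e.
Implicit Types (x y : H) (c : nat -> R[i]) (T : boundedOp H).

Let fourier x (n : nat) := \sum_(i < n) inner x (e i) *: e i.

Lemma basis_ortho i j : inner (e i) (e j) = (i == j)%:R.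
Proof. exact: e_onb.1. Qed.

Lemma inner_fourier x n j :
  inner (fourier x n) (e j) = if (j < n)%N then inner x (e j) else 0.
Proof.
rewrite inner_suml; case: ltnP => jn.
  rewrite (bigD1 (Ordinal jn))//= innerZl basis_ortho eqxx mulr1 big1 ?addr0// => i ij.
  rewrite innerZl basis_ortho (_ : _ == _ = false) ?mulr0//.
  by apply: contra_neqF ij => /eqP ij; exact: val_inj.
rewrite big1// => i _; rewrite innerZl basis_ortho (_ : _ == _ = false) ?mulr0//.
by apply/negbTE; rewrite neq_ltn (leq_trans (ltn_ord i) jn).
Qed.

Lemma bessel x n : \sum_(i < n) nm (inner x (e i)) ^+ 2 <= nm x ^+ 2.
Proof.
rewrite -(orthonormal_nm basis_ortho (fun i => inner x (e i))) -/(fourier x n).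
have -> : nm x ^+ 2 = nm (x - fourier x n) ^+ 2 + nm (fourier x n) ^+ 2.
  rewrite -[in LHS](subrK (fourier x n) x) [LHS]nm_sqrD.
  suff -> : inner (x - fourier x n) (fourier x n) = 0 by rewrite mulr0 addr0.
  rewrite [X in inner _ X]/fourier inner_sumr big1// => i _.
  by rewrite innerZr innerBl inner_fourier ltn_ord subrr mulr0.
by rewrite lerDr sqr_ge0.
Qed.

Lemma fourier_tends x : tends (fourier x) x.
Proof.
have [y xy] := @lincomb_tends _ _ e 1 (nm x ^+ 2) (fun i => inner x (e i))
  (fun c n => ltac:(by rewrite mul1r (orthonormal_nm basis_ortho))) (bessel x).
suff xy' : x = y by rewrite {2}xy'.
apply/eqP; rewrite -subr_eq0; apply/eqP/e_onb.2 => j; rewrite innerBl.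
apply/eqP; rewrite subr_eq0; apply/eqP.
apply: tends_unique (tends_innerl (e j) xy) => d d0.
by exists j.+1 => n jn; rewrite -/(fourier x n) inner_fourier jn subrr nm0.
Qed.

Lemma basis_inner_eq x y : (forall i, inner x (e i) = inner y (e i)) -> x = y.
Proof.
move=> h; apply/eqP; rewrite -subr_eq0; apply/eqP/e_onb.2 => i.
by rewrite innerBl h subrr.
Qed.

Lemma op_basis_eq T T' : (forall i, T (e i) = T' (e i)) -> forall x, T x = T' x.
Proof.
move=> TT' x; apply: tends_unique (tends_op T (fourier_tends x)) _.
have -> : (fun n => T (fourier x n)) = (fun n => T' (fourier x n)).
  apply/funext => n; rewrite /fourier !linear_sum; apply: eq_bigr => i _.
  by rewrite !opZ TT'.
exact: tends_op (fourier_tends x).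
Qed.

(** The operator is defined by [x |-> \sum_i <x, e_i> v_i]; the bound on finite
    combinations of the [v_i] makes this series converge and bounds the sum. *)
Lemma op_on_basis (v : nat -> H) (K : R) : 0 <= K ->
    (forall c n, nm (\sum_(i < n) c i *: v i) ^+ 2 <= K * \sum_(i < n) nm (c i) ^+ 2) ->
  exists T, (forall i, T (e i) = v i) /\ (forall x, nm (T x) ^+ 2 <= K * nm x ^+ 2).
Proof.
move=> K0 vK; pose s x n := \sum_(i < n) inner x (e i) *: v i.
have /choice[f fP] x : exists y, tends (s x) y :=
  @lincomb_tends _ _ v K _ (fun i => inner x (e i)) vK (bessel x).
have flin (a : R[i]) x y : f (a *: x + y) = a *: f x + f y.
  apply: tends_unique (fP _) _.
  have -> : s (a *: x + y) = (fun n => a *: s x n + s y n).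
    apply/funext => n; rewrite scaler_sumr -big_split; apply: eq_bigr => i _.
    by rewrite /= innerDl innerZl scalerDl scalerA.
  apply: tendsD (fP y).
  apply: (@tends_comp _ _ _ (fun z => a *: z) (nm a) (s x)) (fP x) => z w.
  by rewrite -scalerBr nmZ.
have fK x : nm (f x) <= Num.sqrt K * nm x.
  apply: tends_le (fP x) _ => n.
  rewrite -(@ler_pXn2r _ 2)// ?nnegrE ?mulr_ge0 ?nm_ge0 ?sqrtr_ge0//.
  rewrite exprMn sqr_sqrtr//; apply: le_trans (vK (fun i => inner x (e i)) n) _.
  by apply: ler_wpM2l => //; exact: bessel.
have [T Tf] := exists_op flin fK; exists T; split => [i|x].
  rewrite Tf; apply: tends_unique (fP _) _ => d d0; exists i.+1 => n ij.
  rewrite /s (bigD1 (Ordinal ij))//= basis_ortho eqxx scale1r big1 ?addr0 ?subrr ?nm0//.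
  move=> j ji; rewrite basis_ortho (_ : _ == _ = false) ?scale0r//.
  by apply: contra_neqF ji => /eqP ji; exact: val_inj.
rewrite Tf; have := fK x; rewrite -(@ler_pXn2r _ 2)// ?nnegrE ?mulr_ge0 ?nm_ge0 ?sqrtr_ge0//.
by rewrite exprMn sqr_sqrtr.
Qed.

(** The Riesz-Fischer theorem. *)
Lemma exists_coords c (B : R) : (forall n, \sum_(i < n) nm (c i) ^+ 2 <= B) ->
  exists y, forall i, inner y (e i) = c i.
Proof.
move=> cB.
have [y cy] := @lincomb_tends _ _ e 1 B c
  (fun c n => ltac:(by rewrite mul1r (orthonormal_nm basis_ortho))) cB.
exists y => i; apply: tends_unique (tends_innerl (e i) cy) _ => d d0.
exists i.+1 => m im; rewrite inner_suml (bigD1 (Ordinal im))//= innerZl basis_ortho.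
rewrite eqxx mulr1 big1 ?addr0 ?subrr ?nm0// => j ji.
rewrite innerZl basis_ortho (_ : _ == _ = false) ?mulr0//.
by apply: contra_neqF ji => /eqP ji; exact: val_inj.
Qed.

(** The representing vector has coordinates [(l (e i))^*].  These are square
    summable: evaluating [l] on their partial sums gives [S <= K * Num.sqrt S]
    for each partial sum [S] of the squares. *)
Lemma riesz (l : H -> R[i]) (K : R) :
    (forall (a : R[i]) x y, l (a *: x + y) = a * l x + l y) ->
    (forall x, nm (l x) <= K * nm x) ->
  exists y, forall x, l x = inner x y.
Proof.
move=> llin lK; pose c i := (l (e i))^*; pose s n := \sum_(i < n) c i *: e i.
have l0 : l 0 = 0 by have := llin (-1) 0 0; rewrite scaler0 addr0 mulN1r addNr.
have lsum (d : nat -> R[i]) n : l (\sum_(i < n) d i *: e i) = \sum_(i < n) d i * l (e i).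
  elim: n => [|n IH]; first by rewrite !big_ord0.
  by rewrite !big_ord_recr/= addrC llin IH addrC.
have cK n : \sum_(i < n) nm (c i) ^+ 2 <= K ^+ 2.
  set S := \sum_(i < n) _; have S0 : 0 <= S by apply: sumr_ge0 => i _; exact: sqr_ge0.
  have := lK (s n); rewrite lsum.
  have -> : \sum_(i < n) c i * l (e i) = S%:C.
    rewrite rmorph_sum; apply: eq_bigr => i _.
    by rewrite /= /c nmJ -mulCJ mulrC.
  rewrite nm_real ger0_norm// => h.
  have : S ^+ 2 <= K ^+ 2 * S.
    rewrite -[S in K ^+ 2 * S](orthonormal_nm basis_ortho c n) -/(s n) -exprMn.
    by rewrite ler_pXn2r// nnegrE; exact: le_trans h.
  have [->|Sn0] := eqVneq S 0; first by rewrite sqr_ge0.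
  by rewrite expr2 ler_pM2r// lt0r Sn0.
have [y yc] := exists_coords cK.
exists y => x; apply: (@tends_unique _ _ (fun n => l (fourier x n))).
  apply: (@tends_comp _ _ _ l K) (fourier_tends x) => z w.
  have -> : l z - l w = l (z - w) by rewrite [z - w]addrC -(scaleN1r w) llin mulN1r addrC.
  exact: lK.
have -> : (fun n => l (fourier x n)) = (fun n => inner (fourier x n) y).
  apply/funext => n; rewrite /fourier (lsum (fun i => inner x (e i))) inner_suml.
  apply: eq_bigr => i _; rewrite innerZl; congr (_ * _).
  by rewrite (innerC y (e i)) yc; exact/esym/conjcK.
exact: tends_innerl (fourier_tends x).
Qed.

(** By Riesz representation some bounded operator satisfies the equation that
    defines [adjoint], so the choice made there is never the default value. *)
Lemma adjointP T x y : inner (T x) y = inner x (adjoint T y).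
Proof.
suff [S TS] : exists S : boundedOp H, forall x y, inner (T x) y = inner x (S y).
  have := @xgetPex _ idOp [set S : boundedOp H | forall x y, inner (T x) y = inner x (S y)].
  by apply; exists S.
have [K K0 TK] := op_bound T.
have /choice[f fP] z : exists w, forall x, inner (T x) z = inner x w.
  apply: (@riesz (fun x => inner (T x) z) (K * nm z)) => [a u v|u].
    by rewrite opD opZ innerDl innerZl.
  rewrite mulrAC; apply: le_trans (cauchy_schwarz _ _) _.
  by apply: ler_wpM2r; [exact: nm_ge0|exact: TK].
have [a u v|u|S Sf] := @exists_op _ _ f K.
- by apply: inner_eqr => w; rewrite innerDr innerZr -!fP innerDr innerZr.
- have [->|un0] := eqVneq (nm (f u)) 0; first by rewrite mulr_ge0 ?nm_ge0// ltW.
  rewrite -(@ler_pM2l _ (nm (f u))); last by rewrite lt0r un0 nm_ge0.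
  have -> : nm (f u) * nm (f u) = nm (inner (T (f u)) u).
    by rewrite fP inner_nm nm_real ger0_norm ?sqr_ge0// expr2.
  apply: le_trans (cauchy_schwarz _ _) _.
  by rewrite mulrCA mulrA; apply: ler_wpM2r; [exact: nm_ge0|exact: TK].
by exists S => z w; rewrite fP Sf.
Qed.

Lemma adjoint_innerl T x y : inner (adjoint T x) y = inner x (T y).
Proof. by rewrite innerC -adjointP -innerC. Qed.

Lemma adjoint_eq T x y : (forall z, inner z y = inner (T z) x) -> adjoint T x = y.
Proof. by move=> h; apply: inner_eqr => z; rewrite -adjointP h. Qed.

(** Moving the operators across with adjoints, one argument at a time, reduces the
    claim to vectors with equal coordinates. *)
Lemma form_basis_eq (T S T' S' : boundedOp H) :
    (forall i j, inner (T (e i)) (S (e j)) = inner (T' (e i)) (S' (e j))) ->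
  forall x y, inner (T x) (S y) = inner (T' x) (S' y).
Proof.
move=> h x y.
have {}h j : inner (T x) (S (e j)) = inner (T' x) (S' (e j)).
  suff hj : adjoint T (S (e j)) = adjoint T' (S' (e j)) by rewrite adjointP hj -adjointP.
  by apply: basis_inner_eq => i; rewrite !adjoint_innerl !(innerC (_ (e i))) h.
suff hx : adjoint S (T x) = adjoint S' (T' x) by rewrite -adjoint_innerl hx adjoint_innerl.
by apply: basis_inner_eq => j; rewrite !adjoint_innerl h.
Qed.

End Basis.

Section OperatorLemmas.
Context {R : realType} {H : hilbertType R}.

Lemma op_comp (T S : boundedOp H) : exists V : boundedOp H, forall x, V x = T (S x).
Proof.
have [K K0 TK] := op_bound T; have [L L0 SL] := op_bound S.
apply: (@exists_op _ _ (fun x => T (S x)) (K * L)) => [a x y|x].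
  by rewrite !(opD, opZ).
by apply: le_trans (TK _) _; rewrite -mulrA; apply: ler_wpM2l (SL x); exact: ltW.
Qed.

Lemma tends_inner (u v : nat -> H) x y :
  tends u x -> tends v y -> tends (fun n => inner (u n) (v n)) (inner x y).
Proof.
move=> ux vy d d0; have X0 := nm_ge0 x; have Y0 := nm_ge0 y.
pose d' := Num.min 1 (d / (nm x + nm y + 1)).
have d'0 : 0 < d' by rewrite /d' lt_min ltr01 divr_gt0//; lra.
have [n1 h1] := ux _ d'0; have [n2 h2] := vy _ d'0.
exists (maxn n1 n2) => n; rewrite geq_max => /andP[/h1 {}h1 /h2 {}h2].
have -> : inner (u n) (v n) - inner x y =
    (inner (u n - x) (v n - y) + inner (u n - x) y) + inner x (v n - y).
  by rewrite !(innerBl, innerBr); ring.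
have c1 := cauchy_schwarz (u n - x) (v n - y).
have c2 := cauchy_schwarz (u n - x) y; have c3 := cauchy_schwarz x (v n - y).
have t1 := nmD (inner (u n - x) (v n - y) + inner (u n - x) y) (inner x (v n - y)).
have t2 := nmD (inner (u n - x) (v n - y)) (inner (u n - x) y).
have a0 := nm_ge0 (u n - x); have b0 := nm_ge0 (v n - y).
have d1 : d' <= 1 by rewrite ge_min lexx.
have d2 : d' * (nm x + nm y + 1) <= d.
  by rewrite -ler_pdivlMr ?ge_min ?lexx ?orbT//; lra.
have : nm (u n - x) * nm (v n - y) <= nm (u n - x) by nra.
have : nm x * nm (v n - y) <= nm x * d' by nra.
have : nm (u n - x) * nm y <= d' * nm y by nra.
lra.
Qed.

Lemma tends_sum (n : nat) (u : 'I_n -> nat -> R[i]) (l : 'I_n -> R[i]) :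
  (forall i, tends (u i) (l i)) -> tends (fun k => \sum_(i < n) u i k) (\sum_(i < n) l i).
Proof.
elim: n u l => [|n IH] u l ul.
  rewrite big_ord0 (_ : (fun _ => _) = fun=> 0); first exact: tends_cst.
  by apply/funext => k; rewrite big_ord0.
rewrite big_ord_recr (_ : (fun _ => _) =
  fun k => \sum_(i < n) u (widen_ord (leqnSn n) i) k + u ord_max k); last first.
  by apply/funext => k; rewrite big_ord_recr.
by apply: tendsD => //; exact: IH.
Qed.

Lemma tends_Re_le (u : nat -> R[i]) l (B : R) :
  tends u l -> (forall n, Re (u n) <= B) -> Re l <= B.
Proof.
move=> ul uB; apply/ler_addgt0Pr => d d0; have [n h] := ul d d0.
have := h n (leqnn n); have := uB n; have := Re_le (l - u n).
by rewrite ReB nmC; lra.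
Qed.

Lemma tends_ge0 (u : nat -> R[i]) l : tends u l -> (forall n, 0 <= u n) -> 0 <= l.
Proof.
move=> ul u0; rewrite lecE /=; apply/andP; split.
  have small d : 0 < d -> `|Im l| < d.
    move=> /ul[n /(_ n (leqnn n))]; apply: le_lt_trans.
    rewrite -sqrtr_sqr -[nm _]ger0_norm ?nm_ge0// -[`|nm _|]sqrtr_sqr ler_wsqrtr//.
    rewrite nm_sqr; have := u0 n; rewrite lecE => /andP[/eqP/= un _].
    have -> : Im (u n - l) = - Im l by move: (u n) un => [a b]/= ->; case: (l) => c d'; rewrite /= sub0r.
    by rewrite sqrrN lerDr sqr_ge0.
  apply/negPn/negP => l0; have := small `|Im l|.
  by rewrite normr_gt0 eq_sym => /(_ ltac:(by rewrite eq_sym)); rewrite ltxx.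
apply/ler_addgt0Pr => d d0; have [n h] := ul d d0.
have := h n (leqnn n); have := ge0_Re (u0 n); have := Re_le (u n - l).
by rewrite ReB; lra.
Qed.
End OperatorLemmas.

(** * Gram-Schmidt orthonormalization *)
Section GramSchmidt.
Context {R : realType} {H : hilbertType R}.
Implicit Types (x y f : H) (L : seq H).

Let proj L x := \sum_(f <- L) inner x f *: f.

Let projB L x y : proj L (x - y) = proj L x - proj L y.
Proof.
by rewrite /proj -sumrB; apply: eq_bigr => f _; rewrite innerBl scalerBl.
Qed.

Let proj_rcons L f x : proj (rcons L f) x = proj L x + inner x f *: f.
Proof. by rewrite /proj big_rcons/= addrC. Qed.

(** At each stage the first vector of a dense sequence that lies outside the span
    reached so far is orthonormalized.  Such a vector exists, since otherwise the
    span, being closed, would be all of [H]; and after [n] stages the span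
    contains the first [n] vectors of the sequence, so nothing nonzero is
    orthogonal to the whole family. *)
Lemma exists_orthonormal_basis :
  separable H -> ~ finite_dimensional H -> exists e : nat -> H, orthonormal_basis e.
Proof.
move=> /separable_dense_seq[d dP] Hinf.
have new L : exists k, d k - proj L (d k) != 0.
  apply: contrapT => /forallNP h; apply: Hinf; exists (size L), (nth 0 L) => x.
  exists (fun i => inner x (nth 0 L i)).
  rewrite -(big_mkord xpredT (fun i => inner x (nth 0 L i) *: nth 0 L i)).
  rewrite -(big_nth 0 xpredT (fun f => inner x f *: f)) -/(proj L x).
  apply/eqP; rewrite -subr_eq0; apply/eqP/nm_eq0/eqP; rewrite eq_le nm_ge0 andbT.
  apply/ler_addgt0Pr => e e0; rewrite add0r.
  (* [K] bounds the operator [y |-> y - proj L y], which kills every [d k]. *)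
  pose K := 1 + \sum_(f <- L) nm f ^+ 2.
  have K0 : 0 < K.
    by rewrite /K ltr_pwDl// sumr_ge0// => f _; exact: sqr_ge0.
  have [k xk] := dP x (e / K) (divr_gt0 e0 K0).
  have -> : x - proj L x = (x - d k) - proj L (x - d k).
    have /negP := h k; rewrite negbK => /eqP dk.
    by rewrite projB -(subr0_eq dk) opprB subrKA.
  suff h' y : nm (y - proj L y) <= K * nm y.
    apply: le_trans (h' _) _; rewrite mulrC -ler_pdivlMr//; exact: ltW.
  rewrite /K mulrDl mul1r; apply: le_trans (nmD _ _) _; rewrite lerD2l nmN.
  rewrite /proj; elim: L {K K0 xk h} => [|f L IH].
    by rewrite !big_nil nm0 mul0r.
  rewrite !big_cons; apply: le_trans (nmD _ _) _; rewrite mulrDl lerD// nmZ.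
  by rewrite expr2 -mulrA [X in _ <= X]mulrC; apply: ler_wpM2r;
    [exact: nm_ge0|rewrite mulrC; exact: cauchy_schwarz].
pose k L := ex_minn (new L).
pose r L := d (k L) - proj L (d (k L)).
have r0 L : r L != 0 by rewrite /r /k; case: ex_minnP.
have kmin L j : (j < k L)%N -> d j = proj L (d j).
  rewrite /k; case: ex_minnP => m _ hm jm; apply/eqP; rewrite -subr_eq0.
  by apply: contraTT jm => /hm; rewrite leqNgt.
pose F L := ((nm (r L))^-1)%:C *: r L.
have F1 L : inner (F L) (F L) = 1.
  rewrite inner_nm nmZ nm_real ger0_norm ?invr_ge0 ?nm_ge0//.
  by rewrite mulVf ?expr1n//; apply: contraNneq (r0 L) => /nm_eq0 ->.
pose gs := fix gs n := if n is m.+1 then rcons (gs m) (F (gs m)) else [::].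
pose e n := F (gs n).
have projE n x : proj (gs n) x = \sum_(i < n) inner x (e i) *: e i.
  elim: n => [|n IH]; first by rewrite /proj big_nil big_ord0.
  by rewrite big_ord_recr/= proj_rcons IH.
have e_ortho i j : inner (e i) (e j) = (i == j)%:R.
  have lower n : forall i j, (i < n)%N -> (j < n)%N -> inner (e i) (e j) = (i == j)%:R.
    elim: n => // n IH; have orth l : (l < n)%N -> inner (e n) (e l) = 0.
      move=> ln; rewrite {1}/e /F innerZl /r innerBl.
      suff -> : inner (proj (gs n) (d (k (gs n)))) (e l) = inner (d (k (gs n))) (e l).
        by rewrite subrr mulr0.
      rewrite projE inner_suml (bigD1 (Ordinal ln))//= big1 ?addr0 => [|q ql].
        by rewrite innerZl IH// eqxx mulr1.
      rewrite innerZl IH// (_ : _ == _ = false) ?mulr0//.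
      by apply: contra_neqF ql => /eqP ql; exact: val_inj.
    move=> a b; rewrite !ltnS leq_eqVlt => /orP[/eqP->|an]; rewrite leq_eqVlt.
      move=> /orP[/eqP->|bn]; first by rewrite eqxx; exact: F1.
      by rewrite orth// (gtn_eqF bn).
    move=> /orP[/eqP->|bn]; last exact: IH.
    by rewrite innerC orth// rmorph0 (ltn_eqF an).
  by apply: (lower (maxn i j).+1); rewrite ltnS ?leq_maxl ?leq_maxr.
have proj_e n x : inner (proj (gs n) x) (e n) = 0.
  rewrite projE inner_suml big1// => i _; rewrite innerZl e_ortho.
  by rewrite (ltn_eqF (ltn_ord i)) mulr0.
have d_span j n : (j < n)%N -> d j = proj (gs n) (d j).
  have keep x m : x = proj (gs m) x -> x = proj (gs m.+1) x.
    by move=> xm; rewrite /= proj_rcons {3}xm proj_e scale0r addr0 -xm.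
  elim: n j => // n IH j; rewrite ltnS leq_eqVlt => /orP[/eqP{j}->|/IH]; last exact: keep.
  have : (n <= k (gs n))%N.
    rewrite leqNgt; apply/negP => /IH kn.
    by have := r0 (gs n); rewrite /r -kn subrr eqxx.
  rewrite leq_eqVlt => /orP[/eqP nk|/kmin]; last exact: keep.
  have rn : d n = proj (gs n) (d n) + (nm (r (gs n)))%:C *: e n.
    rewrite /e /F scalerA -rmorphM/= divff ?scale1r; last first.
      by apply: contraNneq (r0 (gs n)) => /nm_eq0 ->.
    by rewrite /r -nk addrC subrK.
  rewrite /= proj_rcons [X in inner X]rn innerDl proj_e add0r innerZl.
  by rewrite e_ortho eqxx mulr1 -rn.
exists e; split => // x xe.
have dx j : inner x (d j) = 0.
  rewrite (d_span j j.+1)// projE inner_sumr big1// => i _.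
  by rewrite innerZr xe mulr0.
apply: nm_eq0; apply/eqP; rewrite eq_le nm_ge0 andbT.
apply/ler_addgt0Pr => a a0; rewrite add0r leNgt; apply/negP => ax.
have [j xj] := dP x a a0.
have : nm x ^+ 2 <= nm x * nm (x - d j).
  apply: le_trans (cauchy_schwarz _ _); rewrite innerBr dx subr0 inner_nm nm_real.
  exact: ler_norm.
by rewrite expr2 ler_pM2l ?(lt_trans a0)// leNgt (lt_trans xj).
Qed.
End GramSchmidt.

(** * The Stinespring form of a completely positive map *)
Section StarAlgebra.
Context {R : realType} {A : cstarAlgType R}.
Implicit Types a b c : A.

Lemma cmul_linl b (k : R[i]) a c : (k *: a + c) *c b = k *: (a *c b) + c *c b.
Proof. by rewrite cmulDl cmulZl. Qed.
Lemma cmul_linr b (k : R[i]) a c : b *c (k *: a + c) = k *: (b *c a) + b *c c.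
Proof. by rewrite cmulDr cmulZr. Qed.

Lemma cmul0l a : 0 *c a = 0 :> A.
Proof. by rewrite -(scale0r (0 : A)) cmulZl !scale0r. Qed.
Lemma cmul0r a : a *c 0 = 0 :> A.
Proof. by rewrite -(scale0r (0 : A)) cmulZr !scale0r. Qed.
Lemma cmulBl a b c : (a - b) *c c = a *c c - b *c c.
Proof. by rewrite -scaleN1r cmulDl cmulZl scaleN1r. Qed.
Lemma cmulBr a b c : c *c (a - b) = c *c a - c *c b.
Proof. by rewrite -scaleN1r cmulDr cmulZr scaleN1r. Qed.

Lemma cstar0 : cstar (0 : A) = 0.
Proof. by rewrite -(scale0r (0 : A)) cstarZ rmorph0 !scale0r. Qed.
Lemma cstar1 : cstar (cone : A) = cone.
Proof. by rewrite -[LHS]cmula1 -[X in _ *c X]cstarK -cstarM cmula1 cstarK. Qed.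

Lemma cmul_sumr n (f : 'I_n -> A) a :
  a *c (\sum_(i < n) f i) = \sum_(i < n) a *c f i.
Proof.
by apply: (big_morph (fun x => a *c x)) => [x y|]; rewrite ?cmulDr ?cmul0r.
Qed.
Lemma cstar_sum n (f : 'I_n -> A) :
  cstar (\sum_(i < n) f i) = \sum_(i < n) cstar (f i).
Proof. by apply: big_morph => [x y|]; rewrite ?cstarD ?cstar0. Qed.
Lemma cmul_suml n (f : 'I_n -> A) a :
  (\sum_(i < n) f i) *c a = \sum_(i < n) f i *c a.
Proof.
by apply: (big_morph (fun x => x *c a)) => [x y|]; rewrite ?cmulDl ?cmul0l.
Qed.

Definition cpow a n : A := iter n (cmul a) cone.

Lemma cpowS a n : cpow a n.+1 = a *c cpow a n. Proof. by []. Qed.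
Lemma cpowD a m n : cpow a (m + n) = cpow a m *c cpow a n.
Proof. by elim: m => [|m IH]; rewrite ?cmul1a// addSn !cpowS IH cmulA. Qed.

End StarAlgebra.

(** Cauchy-Schwarz and hermitian symmetry for a positive semidefinite form known
    only through its values on [x + t *: y]: [a] and [b] are the squares of [x]
    and [y], and [d], [d'] the two mixed values.  Symmetry comes from the reality
    of the expression at [t = 1] and [t = 'i]. *)
Lemma psd_cauchy_schwarz (R : realType) (a b d d' : R[i]) :
    0 <= b -> (forall t, 0 <= a + t * d + t^* * d' + (nm t ^+ 2)%:C * b) ->
  d' = d^* /\ nm d ^+ 2 <= Re a * Re b.
Proof.
move=> b0 h.
have a0 : 0 <= a by have := h 0; rewrite rmorph0 !mul0r !addr0 nm0 expr0n/= mul0r addr0.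
have ia := ger0_Im a0; have ib := ger0_Im b0.
have cb (x : R) : Im (x%:C * b) = 0 by case: b ib {b0 h} => p q/= ->; ring.
have dd : d' = d^*.
  have := ger0_Im (h 1); have := ger0_Im (h 'i%C).
  rewrite !ImD !cb ia; case: (d) (d') => [p q] [p' q'] /= h1 h2.
  by apply/eqP; rewrite eq_complex/=; apply/andP; split; apply/eqP; lra.
split=> //; apply: quadratic_disc => [|t]; first exact: ge0_Re.
have := ge0_Re (h t); rewrite dd !ReD ReM_real -rmorphM ReJ; lra.
Qed.

Section StinespringForm.
Context {R : realType} {A : cstarAlgType R} {H : hilbertType R}.
Implicit Types (psi : A -> boundedOp H) (u v : seq (A * H)).

(** A sequence of pairs [(a, x)] stands for a formal sum of tensors in the algebraic
    tensor product of [A] and [H], and [dform psi] is the form on it whose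
    completion is the Stinespring space of [psi]. *)
Definition dform psi u v : R[i] :=
  \sum_(p <- u) \sum_(q <- v) inner (psi (cstar q.1 *c p.1) p.2) q.2.

(** The matrix [(a_i^* a_j)] is [b^* b] for the matrix [b] with first row [(a_j)] and
    zeros elsewhere. *)
Lemma ucp_psd psi u : ucp psi -> 0 <= dform psi u u.
Proof.
case=> _ _ cp; pose t := in_tuple u.
pose a : 'M[A]_(size u) := \matrix_(i, j) (cstar (tnth t i).1 *c (tnth t j).1).
have pa : positive_mx a.
  rewrite /a; case: (size u) t {a} => [|n] t.
    by exists (\matrix_(i, j) 0) => -[].
  exists (\matrix_(i, j) if i == ord0 then (tnth t j).1 else 0) => i j.
  rewrite big_ord_recl !mxE eqxx big1 ?addr0// => k _.
  by rewrite !mxE /= cstar0 cmul0l.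
have := cp _ _ pa (fun i => (tnth t i).2).
rewrite exchange_big/= /dform; congr (0 <= _); rewrite [RHS]big_tnth.
apply: eq_bigr => j _; rewrite [RHS]big_tnth; apply: eq_bigr => i _.
by rewrite !mxE.
Qed.

Lemma dform_catl psi u u' v : dform psi (u ++ u') v = dform psi u v + dform psi u' v.
Proof. by rewrite /dform big_cat. Qed.

Lemma dform_catr psi u v v' : dform psi u (v ++ v') = dform psi u v + dform psi u v'.
Proof. by rewrite /dform -big_split; apply: eq_bigr => p _; rewrite big_cat. Qed.

Let scale (t : R[i]) v : seq (A * H) := [seq (p.1, t *: p.2) | p <- v].

Let dform_scalel psi t u v : dform psi (scale t u) v = t * dform psi u v.
Proof.
rewrite /dform big_map mulr_sumr; apply: eq_bigr => p _.
by rewrite mulr_sumr; apply: eq_bigr => q _; rewrite /= opZ innerZl.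
Qed.

Let dform_scaler psi t u v : dform psi u (scale t v) = t^* * dform psi u v.
Proof.
rewrite /dform mulr_sumr; apply: eq_bigr => p _.
by rewrite big_map mulr_sumr; apply: eq_bigr => q _; rewrite /= innerZr.
Qed.

Lemma dform_cauchy_schwarz psi u v : ucp psi ->
  dform psi u v = (dform psi v u)^* /\
  nm (dform psi v u) ^+ 2 <= Re (dform psi u u) * Re (dform psi v v).
Proof.
move=> psi_ucp; apply: psd_cauchy_schwarz => [|t]; first exact: ucp_psd.
have := ucp_psd (u ++ scale t v) psi_ucp.
rewrite dform_catl !dform_catr !dform_scalel !dform_scaler mulrA -mulCJ !addrA.
by congr (0 <= _); ring.
Qed.

End StinespringForm.

(** * Functionals that behave like Haar measure on the circle *)
Section HaarFunctional.
Context {R : realType} {A : cstarAlgType R}.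
Implicit Types a b c f P : A.

Inductive trigpoly (w : A) : A -> Prop :=
| trigpoly0 : trigpoly w 0
| trigpolyD k i j P : trigpoly w P ->
    trigpoly w (k *: (cstar (cpow w j) *c cpow w i) + P).

Definition sqn (m : A -> R[i]) a : R := Re (m (cstar a *c a)).

Record haar_moments (w : A) (m : A -> R[i]) : Prop := HaarMoments {
  haar_lin : forall k a b, m (k *: a + b) = k * m a + m b;
  haar_conj : forall a, m (cstar a) = (m a)^*;
  haar_ge0 : forall a, 0 <= m (cstar a *c a);
  haar_unitary : cstar w *c w = cone;
  haar_one : m cone = 1;
  haar_pow : forall n, m (cpow w n.+1) = 0
}.

(** [m] is integration against a probability measure for which [w] is Haar
    distributed.  The field [haar_bounded] says that multiplication by an element
    is a bounded operator in mean square, and [haar_dense] that trigonometric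
    polynomials in [w] approximate it in mean square while these operators stay
    bounded by the same [K]. *)
Record haar_functional (w : A) (m : A -> R[i]) : Prop := HaarFunctional {
  haar_functional_moments :> haar_moments w m;
  haar_bounded : forall f, exists2 M : R, 0 <= M &
    forall c, sqn m (f *c c) <= M * sqn m c;
  haar_dense : forall f, exists2 K : R, 0 <= K &
    forall e : R, 0 < e -> exists P, [/\ trigpoly w P, sqn m (f - P) <= e &
      forall c, sqn m (P *c c) <= K * sqn m c]
}.

End HaarFunctional.

Section HardySpace.
Context {R : realType} {A : cstarAlgType R}.
Variables (w : A) (m : A -> R[i]).
Hypothesis cmulC : commutative (cmul : A -> A -> A).
Hypothesis mw : haar_moments w m.
Implicit Types a b c f P : A.

Local Notation g a b := (m (cstar b *c a)).

Lemma haar0 : m 0 = 0.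
Proof. by have := haar_lin mw (-1) 0 0; rewrite scaler0 addr0 mulN1r addNr. Qed.

Lemma haarD a b : m (a + b) = m a + m b.
Proof. by rewrite -[a]scale1r (haar_lin mw) mul1r scale1r. Qed.

Lemma haarZ (k : R[i]) a : m (k *: a) = k * m a.
Proof. by rewrite -[k *: a]addr0 (haar_lin mw) haar0 addr0. Qed.

Lemma haar_sum n (F : 'I_n -> A) : m (\sum_(i < n) F i) = \sum_(i < n) m (F i).
Proof. exact: (big_morph m haarD haar0). Qed.

Lemma sqnE a : m (cstar a *c a) = (sqn m a)%:C.
Proof. exact/ge0_real/(haar_ge0 mw). Qed.

Lemma sqn_ge0 a : 0 <= sqn m a.
Proof. exact/ge0_Re/(haar_ge0 mw). Qed.

Lemma haar_formC a b : g b a = (g a b)^*.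
Proof. by rewrite -(haar_conj mw) cstarM cstarK. Qed.

Lemma cmulAC a b c : a *c b *c c = a *c c *c b.
Proof. by rewrite -!cmulA (cmulC b). Qed.

Lemma cmulACA a b c f : (a *c b) *c (c *c f) = (a *c c) *c (b *c f).
Proof. by rewrite !cmulA (cmulAC a b). Qed.

Lemma cpow_unitary n : cstar (cpow w n) *c cpow w n = cone.
Proof.
elim: n => [|n IH]; first by rewrite cmula1 cstar1.
rewrite cpowS cstarM -cmulA (cmulA (cstar w)) (haar_unitary mw) cmul1a//.
Qed.

Lemma haar_ortho i j : g (cpow w i) (cpow w j) = (i == j)%:R.
Proof.
wlog ij : i j / (j <= i)%N => [h|].
  have [/h//|/ltnW/h ji] := leqP j i; have := haar_formC (cpow w j) (cpow w i).
  by rewrite ji eq_sym => ->; rewrite rmorph_nat.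
rewrite -{1}(subnKC ij) cpowD cmulA cpow_unitary cmul1a.
case: (i - j)%N (subnKC ij) => [|n] <-; first by rewrite addn0 eqxx (haar_one mw).
by rewrite (haar_pow mw) gtn_eqF// -addSnnS leq_addr.
Qed.

(** Analytic polynomials in [w]: the images of the finitely supported vectors under
    the embedding of the Hardy space. *)
Definition cpoly (c : nat -> R[i]) n : A := \sum_(i < n) c i *: cpow w i.

Lemma haar_cpolyl b (c : nat -> R[i]) n : g (cpoly c n) b = \sum_(i < n) c i * g (cpow w i) b.
Proof.
by rewrite cmul_sumr haar_sum; apply: eq_bigr => i _; rewrite cmulZr haarZ.
Qed.

Lemma haar_cpolyr b (c : nat -> R[i]) n : g b (cpoly c n) = \sum_(i < n) (c i)^* * g b (cpow w i).
Proof.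
by rewrite cstar_sum cmul_suml haar_sum; apply: eq_bigr => i _;
  rewrite cstarZ cmulZl haarZ.
Qed.

Lemma haar_cpoly_pow (c : nat -> R[i]) n (j : 'I_n) : g (cpoly c n) (cpow w j) = c j.
Proof.
rewrite haar_cpolyl (bigD1 j)//= haar_ortho eqxx mulr1 big1 ?addr0// => i ij.
by rewrite haar_ortho (_ : _ == _ = false) ?mulr0//; exact: negbTE ij.
Qed.

Lemma sqn_cpoly (c : nat -> R[i]) n : sqn m (cpoly c n) = \sum_(i < n) nm (c i) ^+ 2.
Proof.
apply: complexI; rewrite -sqnE haar_cpolyr rmorph_sum.
by apply: eq_bigr => j _; rewrite haar_cpoly_pow mulrC mulCJ.
Qed.

Lemma sqnD a b : sqn m (a + b) = sqn m a + 2 * Re (g a b) + sqn m b.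
Proof.
rewrite /sqn cstarD cmulDl !cmulDr !haarD !ReD.
by rewrite (haar_formC a b) ReJ; ring.
Qed.

Lemma sqnN a : sqn m (- a) = sqn m a.
Proof. by rewrite /sqn -scaleN1r cstarZ cmulZl cmulZr !haarZ rmorphN1 !mulN1r opprK. Qed.

Lemma sqnD_le a b : sqn m (a + b) <= 2 * sqn m a + 2 * sqn m b.
Proof.
have := sqn_ge0 (a - b); rewrite (sqnD a b) (sqnD a (- b)) sqnN.
have -> : g a (- b) = - g a b.
  by rewrite -scaleN1r cstarZ cmulZl haarZ rmorphN1 mulN1r.
by rewrite ReN; lra.
Qed.

(** Expand the square of [a] minus its projection on the span of the first [n]
    powers of [w]. *)
Lemma haar_bessel a n : \sum_(i < n) nm (g a (cpow w i)) ^+ 2 <= sqn m a.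
Proof.
pose c i := g a (cpow w i); rewrite -(sqn_cpoly c).
have := sqn_ge0 (a - cpoly c n); rewrite sqnD sqnN.
have -> : g a (- cpoly c n) = - (sqn m (cpoly c n))%:C.
  rewrite -scaleN1r cstarZ cmulZl haarZ rmorphN1 mulN1r; congr (- _).
  rewrite haar_cpolyr sqn_cpoly rmorph_sum; apply: eq_bigr => i _.
  by rewrite mulrC mulCJ.
by rewrite ReN /=; lra.
Qed.

End HardySpace.

(** * The Toeplitz map *)
Section ToeplitzMap.
Context {R : realType} {A : cstarAlgType R} {H : hilbertType R}.
Variables (w : A) (m : A -> R[i]) (e : nat -> H).
Hypothesis cmulC : commutative (cmul : A -> A -> A).
Hypothesis mw : haar_functional w m.
Hypothesis e_onb : orthonormal_basis e.
Implicit Types a b f P : A.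

Definition toeplitz_map (phi : A -> boundedOp H) : Prop :=
  forall a i j, inner (phi a (e i)) (e j) = m (cstar (cpow w j) *c (a *c cpow w i)).

(** [xi a] is the projection of [a] on the Hardy space, with the powers of [w]
    identified with the basis [e]; the operator is multiplication by [a] followed
    by [xi]. *)
Lemma exists_toeplitz_map : exists phi, toeplitz_map phi.
Proof.
have /choice[xi xiP] a : exists x, forall i, inner x (e i) = m (cstar (cpow w i) *c a).
  exact: (exists_coords e_onb (haar_bessel mw a)).
suff /choice[phi phiP] a : exists T : boundedOp H, forall i, T (e i) = xi (a *c cpow w i).
  by exists phi => a i j; rewrite phiP xiP.
have [M M0 aM] := haar_bounded mw a.
have [|T [Te _]] := @op_on_basis _ _ e e_onb (fun i => xi (a *c cpow w i)) M M0; last first.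
  by exists T.
move=> c n.
have -> : \sum_(i < n) c i *: xi (a *c cpow w i) = xi (a *c cpoly w c n).
  apply: (basis_inner_eq e_onb) => j; rewrite inner_suml xiP cmul_sumr cmul_sumr.
  rewrite (haar_sum mw); apply: eq_bigr => i _.
  by rewrite innerZl xiP !cmulZr (haarZ mw).
apply: le_trans (_ : sqn m (a *c cpoly w c n) <= _); last first.
  by rewrite -(sqn_cpoly mw); exact: aM.
have := haar_bessel mw (a *c cpoly w c n).
set x := xi _ => h.
apply: (@tends_Re_le R (fun n => inner (\sum_(i < n) inner x (e i) *: e i)
   (\sum_(i < n) inner x (e i) *: e i)) (nm x ^+ 2)%:C).
  by rewrite -inner_nm; apply: tends_inner; exact: fourier_tends.
move=> k; rewrite -nm2E (orthonormal_nm e_onb.1 (fun i => inner x (e i))).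
apply: le_trans (h k); apply: ler_sum => i _.
by rewrite xiP.
Qed.

Variable phi : A -> boundedOp H.
Hypothesis phiP : toeplitz_map phi.

Lemma toeplitz_adj a x y : inner (phi a x) y = inner x (phi (cstar a) y).
Proof.
have := @form_basis_eq _ _ _ e_onb (phi a) idOp idOp (phi (cstar a)).
apply=> i j; rewrite /= [RHS]innerC !phiP -(haar_conj mw) !cstarM !cstarK.
by rewrite cmulA.
Qed.

Lemma toeplitz_inner a (c d : nat -> R[i]) n k :
  inner (phi a (\sum_(i < n) c i *: e i)) (\sum_(i < k) d i *: e i) =
  m (cstar (cpoly w d k) *c (a *c cpoly w c n)).
Proof.
rewrite (haar_cpolyr mw) op_sum inner_suml.
transitivity (\sum_(i < n) \sum_(j < k) c i * ((d j)^* * inner (phi a (e i)) (e j))).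
  apply: eq_bigr => i _; rewrite opZ innerZl -mulr_sumr; congr (_ * _).
  by rewrite inner_sumr; apply: eq_bigr => j _; rewrite innerZr.
rewrite exchange_big; apply: eq_bigr => j _ /=.
rewrite cmul_sumr cmul_sumr (haar_sum mw) mulr_sumr; apply: eq_bigr => i _.
by rewrite !cmulZr (haarZ mw) phiP mulrCA.
Qed.

Lemma toeplitz_lin (k : R[i]) a b x y :
  inner (phi (k *: a + b) x) y = k * inner (phi a x) y + inner (phi b x) y.
Proof.
suff h : phi (k *: a + b) x = k *: phi a x + phi b x.
  by rewrite h innerDl innerZl.
apply: (basis_inner_eq e_onb) => j.
rewrite innerDl innerZl !toeplitz_adj cstarD cstarZ.
suff -> : phi (k^* *: cstar a + cstar b) (e j) =
    k^* *: phi (cstar a) (e j) + phi (cstar b) (e j).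
  by rewrite innerDr innerZr -[in RHS](conjcK k).
apply: (basis_inner_eq e_onb) => i; rewrite innerDl innerZl !phiP.
by rewrite cmulDl cmulZl cmulDr cmulZr (haar_lin mw).
Qed.

Lemma toeplitz_one x : phi cone x = x.
Proof.
have := @op_basis_eq _ _ _ e_onb (phi cone) idOp; apply => i.
apply: (basis_inner_eq e_onb) => j.
by rewrite phiP cmul1a (haar_ortho mw) e_onb.1.
Qed.

(** On finitely supported vectors the form of a positive matrix is a sum of terms
    [m (c^* c)]; continuity extends positivity to all vectors. *)
Lemma toeplitz_ucp : ucp phi.
Proof.
split=> [k a b x|x|n a [b ab] x].
- by apply: inner_eq => y; rewrite toeplitz_lin innerDl innerZl.
- exact: toeplitz_one.
pose p i N := cpoly w (fun l => inner (x i) (e l)) N.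
pose xN i N := \sum_(l < N) inner (x i) (e l) *: e l.
apply: (@tends_ge0 R (fun N => \sum_(i < n) \sum_(j < n)
    inner (phi (a i j) (xN j N)) (xN i N))).
  apply: tends_sum => i; apply: tends_sum => j; apply: tends_inner.
    exact/tends_op/fourier_tends.
  exact: fourier_tends.
move=> N.
have -> : \sum_(i < n) \sum_(j < n) inner (phi (a i j) (xN j N)) (xN i N) =
    \sum_(k < n) m (cstar (\sum_(i < n) b k i *c p i N) *c (\sum_(i < n) b k i *c p i N)).
  have entry i j : inner (phi (a i j) (xN j N)) (xN i N) =
      \sum_(k < n) m (cstar (b k i *c p i N) *c (b k j *c p j N)).
    rewrite /xN (toeplitz_inner _ (fun l => inner (x j) (e l)) (fun l => inner (x i) (e l))).
    rewrite ab cmul_suml cmul_sumr (haar_sum mw); apply: eq_bigr => k _.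
    by rewrite cstarM !cmulA.
  under eq_bigr => i _ do (under eq_bigr => j _ do rewrite entry; rewrite exchange_big).
  rewrite exchange_big; apply: eq_bigr => k _ /=.
  rewrite cstar_sum cmul_suml (haar_sum mw); apply: eq_bigr => i _.
  by rewrite (cmul_sumr (fun j => b k j *c p j N)) (haar_sum mw).
by apply: sumr_ge0 => k _; exact: (haar_ge0 mw).
Qed.

Lemma toeplitz_backshift0 : phi (cstar w) (e 0%N) = 0.
Proof.
apply: (basis_inner_eq e_onb) => j; rewrite phiP cmula1 -cstarM inner0l.
by rewrite (haar_conj mw) -cpowS (haar_pow mw) rmorph0.
Qed.

(** Multiplicativity would give [e 0 = phi (w w^* ) (e 0) = S (phi w^* (e 0)) = 0]. *)
Lemma toeplitz_not_hom : ~ star_homomorphism phi.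
Proof.
case=> _ phiM _.
have := phiM w (cstar w) (e 0%N); rewrite cmulC (haar_unitary mw) toeplitz_one.
rewrite toeplitz_backshift0 op0 => e0; have := e_onb.1 0%N 0%N; rewrite e0 inner0l eqxx => /eqP.
by rewrite eq_sym oner_eq0.
Qed.

Lemma toeplitz_shift i : phi w (e i) = e i.+1.
Proof.
apply: (basis_inner_eq e_onb) => j.
by rewrite phiP -cpowS (haar_ortho mw) e_onb.1.
Qed.

Lemma shift_isometry x y : inner (phi w x) (phi w y) = inner x y.
Proof.
have := @form_basis_eq _ _ _ e_onb (phi w) (phi w) idOp idOp; apply => i j.
by rewrite !toeplitz_shift /= !e_onb.1.
Qed.

Lemma shift_preimage x : inner x (e 0%N) = 0 -> exists y, x = phi w y.
Proof.
move=> x0; exists (phi (cstar w) x); apply: (basis_inner_eq e_onb) => -[|j].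
  rewrite x0 toeplitz_adj.
  by rewrite toeplitz_backshift0 inner0r.
rewrite -{2}toeplitz_shift shift_isometry toeplitz_adj cstarK.
by rewrite toeplitz_shift.
Qed.

Lemma iter_shift_low n x i : (i < n)%N -> inner (iter n (phi w) x) (e i) = 0.
Proof.
elim: i n => [|i IH] [|n]// ij; last by rewrite -toeplitz_shift shift_isometry IH.
rewrite /= toeplitz_adj; by rewrite toeplitz_backshift0 inner0r.
Qed.

(** A vector in the range of every power of the shift has all its coordinates
    zero. *)
Lemma shift_pure x : (forall n, exists y, x = iter n (phi w) y) -> x = 0.
Proof.
move=> h; apply: (basis_inner_eq e_onb) => i; rewrite inner0l.
by have [y ->] := h i.+1; exact: iter_shift_low.
Qed.

End ToeplitzMap.

(** * Completely positive maps dominated by the Toeplitz map *)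
Section Dominated.
Context {R : realType} {A : cstarAlgType R} {H : hilbertType R}.
Variables (w : A) (m : A -> R[i]) (e : nat -> H).
Hypothesis cmulC : commutative (cmul : A -> A -> A).
Hypothesis mw : haar_functional w m.
Hypothesis e_onb : orthonormal_basis e.
Variable phi : A -> boundedOp H.
Hypothesis phiP : toeplitz_map w m e phi.
Implicit Types (a b f P : A) (x y : H).

Definition compress (T : boundedOp H) (u : seq (A * H)) := [seq (p.1, T p.2) | p <- u].

(** The order of completely positive maps, written with the Stinespring forms of
    [T^* psi(.) T] and of [phi]. *)
Definition dominated (psi : A -> boundedOp H) (T : boundedOp H) : Prop :=
  forall u, Re (dform psi (compress T u) (compress T u)) <= Re (dform phi u u).

Let S := phi w.

Section OneDominated.
Variables (psi : A -> boundedOp H) (T : boundedOp H).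
Hypothesis psi_ucp : ucp psi.
Hypothesis psi_dom : dominated psi T.

(** [w] acts on the Hardy space inside the Stinespring space, where it coincides with
    the shift. *)
Lemma toeplitz_null x : dform phi [:: (w, x); (cone, - S x)] [:: (w, x); (cone, - S x)] = 0.
Proof.
rewrite /dform !big_cons !big_nil /= cstar1 !cmula1 !cmul1a (haar_unitary mw).
rewrite (toeplitz_one mw e_onb phiP x) (toeplitz_one mw e_onb phiP (- S x)).
rewrite !opN !innerNl !innerNr -/S !addr0 opprK (shift_isometry mw e_onb phiP).
by rewrite (toeplitz_adj mw e_onb phiP (cstar w)) cstarK (shift_isometry mw e_onb phiP) subrr add0r addNr.
Qed.

(** A vector of length zero for [phi] has length zero for the dominated map, and is
    orthogonal to everything by Cauchy-Schwarz. *)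
Lemma dominated_absorb a x y :
  inner (psi (a *c w) (T x)) (T y) = inner (psi a (T (S x))) (T y).
Proof.
pose u := [:: (w, x); (cone, - S x)]; pose v := [:: (cstar a, T y)].
have [uv cs] := dform_cauchy_schwarz (compress T u) v psi_ucp.
have : dform psi (compress T u) v = 0.
  rewrite uv; apply/eqP; rewrite fmorph_eq0; apply/eqP/nm_eq0/eqP.
  rewrite -sqrf_eq0 eq_le sqr_ge0 andbT; apply: le_trans cs _.
  have := psi_dom u; rewrite toeplitz_null => uu0.
  have vv0 : 0 <= Re (dform psi v v) by apply/ge0_Re/ucp_psd.
  by rewrite mulr_le0_ge0//.
rewrite /dform /= !big_cons !big_nil /= cstarK cmula1 !opN innerNl !addr0.
by move/eqP; rewrite subr_eq0 => /eqP.
Qed.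

(** Schwarz's inequality for the pair [(f, x)], [(1, y)], with the first square
    estimated by [phi]. *)
Lemma dominated_cs f x y :
  nm (inner (psi f (T x)) (T y)) ^+ 2 <=
  Re (inner (phi (cstar f *c f) x) x) * nm (T y) ^+ 2.
Proof.
have [_ psi1 _] := psi_ucp.
have [_] := dform_cauchy_schwarz [:: (cone, T y)] (compress T [:: (f, x)]) psi_ucp.
have := psi_dom [:: (f, x)].
rewrite /dform /= !big_cons !big_nil !addr0 /= cstar1 !cmul1a psi1 inner_nm /=.
move=> fx cs; apply: le_trans cs _; rewrite mulrC; apply: ler_wpM2r fx.
exact: sqr_ge0.
Qed.

Lemma ucp_hermitian f x y : inner (psi f x) y = (inner (psi (cstar f) y) x)^*.
Proof.
have [] := dform_cauchy_schwarz [:: (f, x)] [:: (cone, y)] psi_ucp.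
by rewrite /dform !big_cons !big_nil !addr0 /= cstar1 cmul1a cmula1.
Qed.

Lemma dominated_absorb_pow a i x y :
  inner (psi (a *c cpow w i) (T x)) (T y) = inner (psi a (T (iter i S x))) (T y).
Proof.
elim: i x => [|i IH] x; first by rewrite cmula1.
by rewrite cpowS (cmulC w) cmulA dominated_absorb IH iterSr.
Qed.

Lemma dominated_moment i j x y :
  inner (psi (cstar (cpow w j) *c cpow w i) (T x)) (T y) =
  inner (T (iter i S x)) (T (iter j S y)).
Proof.
have [_ psi1 _] := psi_ucp.
rewrite dominated_absorb_pow ucp_hermitian cstarK -[cpow w j]cmul1a.
by rewrite dominated_absorb_pow psi1 -innerC.
Qed.

Lemma dominated_isometry x y : inner (T (S x)) (T (S y)) = inner (T x) (T y).
Proof.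
have [_ psi1 _] := psi_ucp.
by rewrite -(dominated_moment 1 1) /cpow/= cmula1 (haar_unitary mw) psi1.
Qed.

Variable Ti : boundedOp H.
Hypotheses (TK : cancel T Ti) (TiK : cancel Ti T).

(** Wold decomposition of the isometry [T S T^-1].  The vector [adjoint Ti (e 0)] is
    orthogonal to the range of [T S], and a vector orthogonal to it lies in that
    range.  Hence a vector orthogonal to all [f n] can be pulled back along the
    isometry indefinitely, which the shift allows for 0 only. *)
Lemma wandering_unitary : exists2 U : boundedOp H, unitary_op U &
  forall i x, U (iter i S x) = T (iter i S (Ti (U x))).
Proof.
pose h0 := adjoint Ti (e 0%N).
have h0T x : inner (T x) h0 = inner x (e 0%N).
  by rewrite /h0 -(adjointP e_onb) TK.
have h0n0 : nm h0 != 0.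
  apply: contra_eqN (h0T (e 0%N)) => /eqP/nm_eq0 ->.
  by rewrite e_onb.1 eqxx inner0r eq_sym oner_eq0.
pose h := ((nm h0)^-1)%:C *: h0.
have h1 : inner h h = 1.
  by rewrite inner_nm nmZ nm_real ger0_norm ?invr_ge0 ?nm_ge0// mulVf// expr1n.
have hT x : inner (T (S x)) h = 0.
  by rewrite innerZr h0T (iter_shift_low mw e_onb phiP (n := 1) x (i := 0))// mulr0.
pose f n := T (iter n S (Ti h)).
have f0 : f 0%N = h by exact: TiK.
have f_ortho i j : inner (f i) (f j) = (i == j)%:R.
  elim: i j => [|i IH] [|j]; rewrite ?f0 //=.
  - by rewrite innerC hT rmorph0.
  - by rewrite hT.
  - by rewrite /f /= dominated_isometry; exact: IH.
have f_onb : orthonormal_basis f.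
  split=> // y yf; rewrite -(TiK y) [Ti y](shift_pure mw e_onb phiP) ?op0// => n.
  suff [z [yz _]] : exists z, Ti y = iter n S z /\ forall k, inner (T z) (f k) = 0.
    by exists z.
  elim: n => [|n [z [yz zf]]]; first by exists (Ti y); split=> // k; rewrite TiK.
  have [|z' zz'] := @shift_preimage _ _ _ w m e mw e_onb phi phiP z.
    have := zf 0%N; rewrite f0 innerZr h0T => /eqP; rewrite mulf_eq0 => /orP[|/eqP//].
    by rewrite fmorph_eq0 eq_complex/= eqxx andbT invr_eq0 (negbTE h0n0).
  exists z'; split=> [|k]; first by rewrite iterSr -zz'.
  by have := zf k.+1; rewrite zz' /f /= dominated_isometry.
have [|U [Ue _]] := @op_on_basis _ _ e e_onb f 1 ler01.
  by move=> c n; rewrite (orthonormal_nm f_ortho) mul1r.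
have Uiso x y : inner (U x) (U y) = inner x y.
  have := @form_basis_eq _ _ _ e_onb U U idOp idOp; apply => i j.
  by rewrite !Ue f_ortho /= e_onb.1.
have US x : U (S x) = T (S (Ti (U x))).
  have [V1 V1E] := op_comp U S; have [V2 V2E] := op_comp Ti U.
  have [V3 V3E] := op_comp S V2; have [V4 V4E] := op_comp T V3.
  rewrite -V1E -V2E -V3E -V4E; apply: (op_basis_eq e_onb) => i.
  rewrite V1E V4E V3E V2E /S (toeplitz_shift mw e_onb phiP) !Ue.
  by rewrite /f TK.
exists U => [|i x]; last first.
  elim: i => [|i IH] /=; first by rewrite TiK.
  by rewrite US IH TK.
split=> x; first by apply: (adjoint_eq e_onb) => z; rewrite Uiso.
apply: (basis_inner_eq f_onb) => i.
by rewrite -Ue Uiso (adjoint_innerl e_onb).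
Qed.

End OneDominated.

Lemma toeplitz_dominated_self : dominated phi idOp.
Proof. by move=> u; rewrite /compress (eq_map (g := id)) ?map_id// => -[]. Qed.

Let Q g x := Re (inner (phi (cstar g *c g) x) x).

Lemma toeplitz_Q g (c : nat -> R[i]) n :
  Q g (\sum_(i < n) c i *: e i) = sqn m (g *c cpoly w c n).
Proof. by rewrite /Q (toeplitz_inner mw phiP) /sqn cstarM !cmulA. Qed.

(** [K] bounds multiplication by [g] on the Hardy space; the inequality passes from
    finitely supported vectors to all vectors. *)
Lemma toeplitz_Q_le g (K : R) : 0 <= K ->
  (forall c, sqn m (g *c c) <= K * sqn m c) -> forall x, Q g x <= K * nm x ^+ 2.
Proof.
move=> K0 gK x; pose xN N := \sum_(l < N) inner x (e l) *: e l.
apply: (@tends_Re_le R (fun N => inner (phi (cstar g *c g) (xN N)) (xN N))).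
  by apply: tends_inner; [apply: tends_op|]; exact: fourier_tends.
move=> N; have := toeplitz_Q g (fun l => inner x (e l)) N; rewrite /Q => ->.
apply: le_trans (gK _) _; rewrite (sqn_cpoly mw); apply: ler_wpM2l => //.
exact: bessel.
Qed.

Lemma toeplitz_Q_D g x y : Q g (x + y) <= 2 * Q g x + 2 * Q g y.
Proof.
have p z : 0 <= Q g z.
  have := ucp_psd [:: (g, z)] (toeplitz_ucp mw e_onb phiP).
  by rewrite /dform !big_cons !big_nil !addr0 /= => /ge0_Re.
have := p (x - y); rewrite /Q !(opB, innerBl, innerBr) !(opD, innerDl, innerDr).
by rewrite !ReB !ReD; lra.
Qed.

(** Mean-square smallness of [g] controls [Q g] only on finitely supported vectors.
    The common bound [K] takes care of the remaining tail of [x]. *)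
Lemma toeplitz_approx (K : R) x (d : R) : 0 <= K -> 0 < d -> exists2 r : R, 0 < r &
  forall g, sqn m g <= r -> (forall c, sqn m (g *c c) <= K * sqn m c) -> Q g x <= d.
Proof.
move=> K0 d0; pose xN N := \sum_(l < N) inner x (e l) *: e l.
pose s := d / (4 * (K + 1)).
have s0 : 0 < s by apply: divr_gt0 => //; lra.
have sm : 0 < Num.min 1 s by rewrite lt_min ltr01.
have [N /(_ N (leqnn N)) xNs] := @fourier_tends _ _ e e_onb x _ sm.
have [M M0 pM] := haar_bounded mw (cpoly w (fun l => inner x (e l)) N).
exists (d / (4 * (M + 1))) => [|g gr gK]; first by apply: divr_gt0 => //; lra.
rewrite -(subrK (xN N) x) addrC; apply: le_trans (toeplitz_Q_D _ _ _) _.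
rewrite (toeplitz_Q g (fun l => inner x (e l)) N) cmulC.
have h1 := pM g.
have := toeplitz_Q_le K0 gK (x - xN N).
move: xNs; rewrite nmC lt_min -/(xN N) => /andP[n1 n2] h2.
have n0 := nm_ge0 (x - xN N).
have n3 : nm (x - xN N) ^+ 2 <= s
    by apply: le_trans (ltW n2); rewrite expr2 -[leRHS]mul1r ler_wpM2r// ltW.
have h3 : K * nm (x - xN N) ^+ 2 <= d / 4.
  apply: le_trans (_ : K * s <= _); first exact: ler_wpM2l.
  rewrite /s mulrA ler_pdivrMr ?mulr_gt0//; nra.
have h4 : M * sqn m g <= d / 4.
  apply: le_trans (_ : M * (d / (4 * (M + 1))) <= _); first exact: ler_wpM2l.
  rewrite mulrA ler_pdivrMr ?mulr_gt0//; nra.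
lra.
Qed.

Lemma ucp_inner_lin psi (k : R[i]) a b x y : ucp psi ->
  inner (psi (k *: a + b) x) y = k * inner (psi a x) y + inner (psi b x) y.
Proof. by case=> psi_lin _ _; rewrite psi_lin innerDl innerZl. Qed.

Lemma unitary_inner (U : boundedOp H) x y : unitary_op U -> inner (U x) (U y) = inner x y.
Proof. by case=> UK _; rewrite (adjointP e_onb) UK. Qed.

(** Both sides are determined on monomials by [dominated_moment], applied to [psi] and
    to [phi] itself. *)
Lemma trigpoly_moments psi T (U : boundedOp H) x x' y y' P :
    ucp psi -> dominated psi T ->
    (forall i, T (iter i S x') = U (iter i S x)) ->
    (forall i, T (iter i S y') = U (iter i S y)) -> unitary_op U ->
  trigpoly w P -> inner (psi P (T x')) (T y') = inner (phi P x) y.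
Proof.
move=> psi_ucp psi_dom Ux Uy U_unit; have phi_ucp := toeplitz_ucp mw e_onb phiP.
have zero (chi : A -> boundedOp H) z t : ucp chi -> inner (chi 0 z) t = 0.
  move=> chi_ucp; have := ucp_inner_lin (-1) 0 0 z t chi_ucp.
  by rewrite scaler0 addr0 mulN1r addNr.
elim=> [|k i j {}P _ IH]; first by rewrite !zero.
rewrite !ucp_inner_lin// IH (dominated_moment psi_ucp psi_dom) Ux Uy unitary_inner//.
by rewrite -(dominated_moment phi_ucp toeplitz_dominated_self).
Qed.

(** The intertwining unitary matches the two maps on trigonometric polynomials.  For
    a general [f] take a trigonometric polynomial [P] near [f]: both maps are
    small at [f - P] by [dominated_cs], since [toeplitz_approx] applies to [f - P]
    with a bound that does not depend on [P]. *)
Lemma dominated_unitary_equiv psi (T Ti : boundedOp H) :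
    ucp psi -> dominated psi T -> cancel T Ti -> cancel Ti T ->
  exists2 U : boundedOp H, unitary_op U & forall a x, phi a x = adjoint U (psi a (U x)).
Proof.
move=> psi_ucp psi_dom TK TiK.
have phi_ucp := toeplitz_ucp mw e_onb phiP.
have [U U_unit US] := wandering_unitary psi_ucp psi_dom TK TiK.
exists U => // f x; apply: inner_eq => y; rewrite (adjoint_innerl e_onb).
have TU i z : T (iter i S (Ti (U z))) = U (iter i S z) by rewrite US.
have nmU z : nm (U z) = nm z.
  by apply/eqP; rewrite -(@eqrXn2 _ 2) ?nm_ge0// !nm2E unitary_inner.
apply/eqP; rewrite -subr_eq0; apply/eqP/nm_eq0/eqP.
rewrite eq_le nm_ge0 andbT; apply/ler_addgt0Pr => d d0; rewrite add0r.
have [M M0 fM] := haar_bounded mw f; have [K K0 fK] := haar_dense mw f.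
have C0 : 0 <= 2 * M + 2 * K by lra.
pose q := (d / 2) ^+ 2 / (nm y ^+ 2 + 1).
have y1 : 0 < nm y ^+ 2 + 1 by have := sqr_ge0 (nm y); lra.
have q0 : 0 < q by apply: divr_gt0 => //; apply: exprn_gt0; lra.
have [r1 r10 h1] := toeplitz_approx x C0 q0.
have [r2 r20 h2] := toeplitz_approx (Ti (U x)) C0 q0.
have [|P [Ptrig Pf PK]] := fK (Num.min r1 r2); first by rewrite lt_min r10.
have gK c : sqn m ((f - P) *c c) <= (2 * M + 2 * K) * sqn m c.
  rewrite cmulBl; apply: le_trans (sqnD_le mw _ _) _; rewrite (sqnN mw).
  by have := fM c; have := PK c; lra.
have {h1}h1 : Q (f - P) x <= q.
  by apply: h1 gK; apply: le_trans Pf _; rewrite ge_min lexx.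
have {h2}h2 : Q (f - P) (Ti (U x)) <= q.
  by apply: h2 gK; apply: le_trans Pf _; rewrite ge_min lexx orbT.
have fE (chi : A -> boundedOp H) z t : ucp chi ->
    inner (chi f z) t = inner (chi (f - P) z) t + inner (chi P z) t.
  by move=> chi_ucp; rewrite -[f in LHS](subrK P) -[f - P in LHS]scale1r ucp_inner_lin// mul1r.
have half (chi : A -> boundedOp H) V z t : ucp chi -> dominated chi V ->
    nm (V t) = nm y -> Q (f - P) z <= q ->
    nm (inner (chi (f - P) (V z)) (V t)) <= d / 2.
  move=> chi_ucp chi_dom Vt zq.
  rewrite -(@ler_pXn2r _ 2)// ?nnegrE ?nm_ge0//; last lra.
  apply: le_trans (dominated_cs chi_ucp chi_dom _ _ _) _; rewrite Vt.
  apply: le_trans (_ : q * nm y ^+ 2 <= _); first exact: ler_wpM2r (sqr_ge0 _) _ _ zq.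
  rewrite /q mulrAC ler_pdivrMr//; apply: ler_wpM2l; first exact: sqr_ge0.
  by lra.
have k1 := half _ _ _ _ phi_ucp toeplitz_dominated_self erefl h1.
have := half _ _ _ (Ti (U y)) psi_ucp psi_dom _ h2.
rewrite !TiK nmU => /(_ erefl) k2.
rewrite !(fE _ _ _ psi_ucp) !(fE _ _ _ phi_ucp).
have -> : inner (psi P (U x)) (U y) = inner (phi P x) y.
  have := @trigpoly_moments psi T U x (Ti (U x)) y (Ti (U y)) P psi_ucp psi_dom.
  by rewrite !TiK; apply.
rewrite opprD addrACA subrr addr0; apply: le_trans (nmD _ _) _; rewrite nmN.
by rewrite /= in k1; lra.
Qed.

(** Each term of a decomposition of [phi] is dominated by [phi], because the forms of
    the other terms are positive. *)
Theorem toeplitz_cstar_extreme : cstar_extreme phi.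
Proof.
split; first exact: (toeplitz_ucp mw e_onb phiP).
move=> n psi T psi_ucp T_inv _ phiE i; have [Ti [TK TiK]] := T_inv i.
apply: (@dominated_unitary_equiv (psi i) (T i) Ti) => // u.
have -> : dform phi u u = \sum_(j < n) dform (psi j) (compress (T j) u) (compress (T j) u).
  have entry p q : inner (phi (cstar q.1 *c p.1) p.2) q.2 =
      \sum_(j < n) inner (psi j (cstar q.1 *c p.1) (T j p.2)) (T j q.2).
    by rewrite phiE inner_suml; apply: eq_bigr => j _; exact: (adjoint_innerl e_onb).
  rewrite /dform; under eq_bigr => p _ do
    (under eq_bigr => q _ do rewrite entry; rewrite exchange_big).
  rewrite exchange_big; apply: eq_bigr => j _; rewrite [RHS]big_map.
  by apply: eq_bigr => p _; rewrite [RHS]big_map.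
rewrite (bigD1 i)//= ReD lerDl (big_morph _ ReD (erefl : Re (0 : R[i]) = 0)).
by apply: sumr_ge0 => j _; apply/ge0_Re/ucp_psd.
Qed.

End Dominated.

(** * Characters are contractive *)
Section Character.
Context {R : realType} {A : cstarAlgType R}.
Implicit Types a b : A.

Lemma geometric_small (r K e : R) : 0 <= r < 1 -> 0 < e ->
  exists n0, forall n, (n0 <= n)%N -> K * r ^+ n < e.
Proof.
move=> /andP[r0 r1] e0.
have k0 : 0 < `|K| + 1 by have := normr_ge0 K; lra.
have /cvgrPdist_lt/(_ (e / (`|K| + 1))) : (fun n => r ^+ n) @ \oo --> (0 : R).
  by apply: cvg_expr; rewrite ger0_norm.
case=> [|n0 _ h]; first exact: divr_gt0.
exists n0 => n /h/=; rewrite sub0r normrN ger0_norm ?exprn_ge0// ltr_pdivlMr// => {}h.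
apply: le_lt_trans _ h; rewrite mulrC; apply: ler_wpM2l; first exact: exprn_ge0.
by have := ler_norm K; lra.
Qed.

Lemma nm_cmul a b : nm (a *c b) <= nm a * nm b.
Proof. by rewrite -lecR rmorphM/= -!nmE cnormM. Qed.

(** The inverse is the sum of the geometric series. *)
Lemma neumann_inverse a : nm a < 1 -> exists b, (cone - a) *c b = cone.
Proof.
move=> a1; have a0 := nm_ge0 a; pose s n := \sum_(i < n) cpow a i.
have sE n : (cone - a) *c s n = cone - cpow a n.
  elim: n => [|n IH]; first by rewrite /s big_ord0 cmul0r subrr.
  by rewrite /s big_ord_recr/= cmulDr IH cmulBl cmul1a -cpowS subrKA.
have an n : nm (cpow a n) <= nm (cone : A) * nm a ^+ n.
  elim: n => [|n IH]; first by rewrite mulr1.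
  apply: le_trans (nm_cmul _ _) _; rewrite exprS mulrCA.
  exact: ler_wpM2l.
have small (e : R) : 0 < e -> exists n0, forall n, (n0 <= n)%N -> nm (cpow a n) < e.
  move=> e0; have [|n0 h] := @geometric_small (nm a) (nm (cone : A)) e _ e0.
    by rewrite a0.
  by exists n0 => n /h; exact: le_lt_trans.
have tail m n : (m <= n)%N ->
    (1 - nm a) * nm (s n - s m) <= nm (cone : A) * nm a ^+ m.
  move=> mn; have -> : s n - s m = \sum_(i < (n - m)%N) cpow a (m + i).
    by rewrite -[n in s n](subnKC mn) /s big_split_ord /= addrAC subrr add0r.
  move: (n - m)%N => k; elim: k m {mn} => [|k IH] l.
    by rewrite big_ord0 nm0 mulr0 mulr_ge0 ?nm_ge0 ?exprn_ge0.
  rewrite big_ord_recl addn0.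
  under eq_bigr => i _ do rewrite lift0 addnS -addSn.
  have := IH l.+1; rewrite exprS; have := an l.
  set t := nm a ^+ l; have t0 : 0 <= t by exact: exprn_ge0.
  have := nmD (cpow a l) (\sum_(i < k) cpow a (l.+1 + i)).
  set S := nm (_ + _); set u := nm (cpow _ _); set v := nm (\sum_(_ < _) _).
  move=> Suv ut; have : (1 - nm a) * S <= (1 - nm a) * (u + v) by apply: ler_wpM2l => //; lra.
  have : (1 - nm a) * u <= (1 - nm a) * (nm (cone : A) * t) by apply: ler_wpM2l => //; lra.
  lra.
have [|b sb] := @tends_complete _ _ s.
  move=> e e0; have e1 : 0 < (1 - nm a) * e by apply: mulr_gt0 => //; lra.
  have [|n0 h] := @geometric_small (nm a) (nm (cone : A)) _ _ e1; first by rewrite a0.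
  exists n0 => m n mn nn; wlog le : m n mn nn / (n <= m)%N => [hw|].
    by have [/hw|/ltnW/hw] := leqP n m; [apply|rewrite nmC; apply].
  rewrite -(@ltr_pM2l _ (1 - nm a)); last lra.
  exact: le_lt_trans (tail _ _ le) (h _ nn).
exists b; apply: (@tends_unique _ _ (fun n => (cone - a) *c s n)).
  apply: (@tends_comp _ _ _ (fun z => (cone - a) *c z) (nm (cone - a))) sb => x y.
  by rewrite -cmulBr; exact: nm_cmul.
move=> e /small[n0 h]; exists n0 => n /h; rewrite sE addrAC subrr add0r nmN.
exact.
Qed.

(** If [nm a < nm (chi a)] then [1 - a / chi a] is invertible by the Neumann series,
    although [chi] maps it to 0. *)
Lemma character_contractive (chi : A -> R[i]) :
    (forall (k : R[i]) a b, chi (k *: a + b) = k * chi a + chi b) ->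
    (forall a b, chi (a *c b) = chi a * chi b) -> chi cone = 1 ->
  forall a, nm (chi a) <= nm a.
Proof.
move=> chi_lin chiM chi1 a; rewrite leNgt; apply/negP => ha.
have c0 : chi a != 0.
  by apply: contraTneq ha => ->; rewrite nm0 -leNgt nm_ge0.
have [|b hb] := @neumann_inverse ((chi a)^-1 *: a).
  have h : nm (chi a) * nm (chi a)^-1 = 1 by rewrite -nmM divff ?nm1.
  have h0 : 0 < nm (chi a) by apply: le_lt_trans ha; exact: nm_ge0.
  by rewrite nmZ -(@ltr_pM2l _ (nm (chi a)))// mulrA h mul1r mulr1.
have := congr1 chi hb; rewrite chiM chi1 addrC -scaleN1r scalerA chi_lin chi1.
by rewrite mulN1r mulNr mulVf// addNr mul0r => /eqP; rewrite eq_sym oner_eq0.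
Qed.

End Character.

(** * Continuous complex functions *)
Section ContinuousFunctions.
Context {R : realType} {X : topologicalType}.

Lemma continuousCP (f : X -> R[i]^o) : continuous f <->
  forall x (e : R), 0 < e -> \forall y \near x, nm (f x - f y : R[i]) < e.
Proof.
split=> [fc x e e0|h x].
  have /cvgrPdist_lt/(_ e%:C) := fc x; rewrite ltcR => /(_ e0).
  by apply: filterS => y; rewrite -ltcR -nmE.
apply/cvgrPdist_lt => e e0; have er := ge0_real (ltW e0).
have e0' : 0 < Re e by rewrite -ltcR -er.
by have := h x _ e0'; apply: filterS => y; rewrite er -ltcR -nmE.
Qed.

Lemma continuousRP (f : X -> R) : continuous f <->
  forall x (e : R), 0 < e -> \forall y \near x, `|f x - f y| < e.
Proof.
split=> [fc x e e0|h x]; first by have /cvgrPdist_lt := fc x; apply.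
by apply/cvgrPdist_lt => e e0; exact: h.
Qed.

Lemma nm_complex_le (z : R[i]) : nm z <= `|Re z| + `|Im z|.
Proof.
rewrite -(@ler_pXn2r _ 2)// ?nnegrE ?addr_ge0 ?nm_ge0// nm_sqr.
rewrite -(real_normK (num_real (Re z))) -(real_normK (num_real (Im z))) sqrrD.
by rewrite addrAC lerDl mulrn_wge0// mulr_ge0.
Qed.

Lemma normIm_le (z : R[i]) : `|Im z| <= nm z.
Proof.
rewrite -(@ler_pXn2r _ 2)// ?nnegrE ?nm_ge0// nm_sqr real_normK ?num_real//.
by rewrite lerDr sqr_ge0.
Qed.

Lemma continuous_Complex (u v : X -> R) :
  continuous u -> continuous v -> continuous (fun x => (u x +i* v x)%C : R[i]^o).
Proof.
move=> /continuousRP uc /continuousRP vc; apply/continuousCP => x e e0.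
have e2 : 0 < e / 2 by lra.
have := vc x _ e2; have := uc x _ e2; apply: filterS2 => y h1 h2.
by apply: le_lt_trans (nm_complex_le _) _ => /=; lra.
Qed.

Lemma continuous_real_complex (u : X -> R) :
  continuous u -> continuous (fun x => (u x)%:C : R[i]^o).
Proof. by move=> uc; apply: continuous_Complex => //; exact: cst_continuous. Qed.

Lemma continuous_Re (f : X -> R[i]^o) : continuous f -> continuous (fun x => Re (f x)).
Proof.
move=> /continuousCP fc; apply/continuousRP => x e e0.
have := fc x _ e0; apply: filterS => y; apply: le_lt_trans.
by rewrite -ReB; exact: normRe_le.
Qed.

Lemma ImB (z t : R[i]) : Im (z - t) = Im z - Im t. Proof. exact: raddfB. Qed.

Lemma continuous_Im (f : X -> R[i]^o) : continuous f -> continuous (fun x => Im (f x)).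
Proof.
move=> /continuousCP fc; apply/continuousRP => x e e0.
have := fc x _ e0; apply: filterS => y; apply: le_lt_trans.
by rewrite -ImB; exact: normIm_le.
Qed.

End ContinuousFunctions.

(** * A Cantor scheme in an uncountable space *)
Section CantorScheme.
Context {R : realType} {X : topologicalType}.
Variable h : nat -> X -> R.
Hypothesis h_cont : forall k, continuous (h k).
Hypothesis h_sep : forall x y, (forall k, h k x = h k y) -> x = y.
Implicit Types F : set X.

Let uncountable_closed F := closed F /\ ~ countable F.

Lemma closed_sublevel k (c : R) : closed [set x | h k x <= c].
Proof. exact: (closed_comp (fun x _ => h_cont (x := x)) (@closed_le R c)). Qed.

Lemma closed_superlevel k (c : R) : closed [set x | c <= h k x].
Proof. exact: (closed_comp (fun x _ => h_cont (x := x)) (@closed_ge R c)). Qed.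

(** Remove from [F] all its countable pieces cut out by a condition [h k <= q] or
    [q <= h k] with [q] rational.  What is left is uncountable.  Two of its points
    are separated by some [h k] and two rationals, and the two corresponding
    pieces of [F] cannot be countable. *)
Lemma uncountable_split F : uncountable_closed F ->
  exists F0 F1, [/\ uncountable_closed F0, uncountable_closed F1,
    F0 `<=` F, F1 `<=` F & F0 `&` F1 = set0].
Proof.
move=> [Fcl Func].
pose piece (i : nat * rat * bool) : set X := F `&`
  if i.2 then [set x | h i.1.1 x <= ratr i.1.2] else [set x | ratr i.1.2 <= h i.1.1 x].
pose N := \bigcup_(i in [set i | countable (piece i)]) piece i.
have Ncount : countable N by apply: bigcup_countable => //; exact: countableP.
have big Z : countable Z -> exists2 x, (F `\` N) x & ~ Z x.
  move=> Zc; apply: contrapT => hn; apply: Func.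
  apply: (@sub_countable _ _ _ (N `|` Z)); last first.
    by rewrite -bigcup2inE; apply: bigcup_countable => // -[|[|]]// _.
  apply: subset_card_le => x Fx; have [Nx|nNx] := pselect (N x); [by left|right].
  by apply: contrapT => nZx; apply: hn; exists x.
have [x [Fx Nx] _] := big set0 (countable0 _).
have [y [Fy Ny] yx] := big [set x] (countable1 x).
have [k] : exists k, h k x != h k y.
  by apply: contrapT => /forallNP hk; apply: yx; apply/esym/h_sep => k;
    apply/eqP/negPn/negP/hk.
wlog : x y Fx Nx Fy Ny {yx} / h k x < h k y => [hw|hxy _].
  rewrite neq_lt => /orP[xy|xy]; first by apply: (hw x y Fx Nx Fy Ny xy); rewrite lt_eqF.
  by apply: (hw y x Fy Ny Fx Nx xy); rewrite lt_eqF.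
have [q] := rat_in_itvoo hxy; rewrite in_itv/= => /andP[xq qy].
have [q'] := rat_in_itvoo qy; rewrite in_itv/= => /andP[qq' q'y].
exists (piece (k, q, true)), (piece (k, q', false)); split.
- split; first by apply: closedI => //; exact: closed_sublevel.
  by move=> pc; apply: Nx; exists (k, q, true) => //; split=> //=; exact: ltW.
- split; first by apply: closedI => //; exact: closed_superlevel.
  by move=> pc; apply: Ny; exists (k, q', false) => //; split=> //=; exact: ltW.
- by move=> z [].
- by move=> z [].
- apply/seteqP; split=> // z [[_ /= zq] [_ /= q'z]].
  by have := lt_le_trans qq' (le_trans q'z zq); rewrite ltxx.
Qed.

(** Countably many pieces on which [h k] varies by at most [e] cover [F]. *)
Lemma uncountable_shrink F k (e : R) : 0 < e -> uncountable_closed F ->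
  exists2 F', uncountable_closed F' &
    F' `<=` F /\ forall x y, F' x -> F' y -> `|h k x - h k y| <= e.
Proof.
move=> e0 [Fcl Func].
pose piece (q : rat) := F `&` ([set x | ratr q <= h k x] `&` [set x | h k x <= ratr q + e]).
have [q qunc] : exists q, ~ countable (piece q).
  apply: contrapT => /forallNP hn; apply: Func.
  apply: (@sub_countable _ _ _ (\bigcup_q piece q)); last first.
    by apply: bigcup_countable => [|q _]; [exact: countableP|by apply: contrapT; exact: hn].
  apply: subset_card_le => x Fx.
  have [|q] := @rat_in_itvoo _ (h k x - e) (h k x); first lra.
  by rewrite in_itv/= => /andP[q1 q2]; exists q => //; split=> //; split=> /=; lra.
exists (piece q); split=> //.
- apply: closedI => //; apply: closedI; [exact: closed_superlevel|exact: closed_sublevel].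
- by move=> x [].
- by move=> x y [_ [/= x1 x2]] [_ [/= y1 y2]]; rewrite ler_norml; lra.
Qed.

(** Words list their most recent letter first, so [b :: s] continues [s].  The
    sequence [unpickle] runs through all pairs [(k, j)], and the step made at
    level [pickle (k, j)] reduces the oscillation of [h k] to [1 / (j + 1)]. *)
Lemma cantor_scheme : ~ countable [set: X] -> exists F : seq bool -> set X,
  [/\ forall s, closed (F s) /\ F s !=set0,
      forall b s, F (b :: s) `<=` F s,
      forall s, F (true :: s) `&` F (false :: s) = set0 &
      forall k (e : R), 0 < e -> exists n0, forall s, (n0 <= size s)%N ->
        forall x y, F s x -> F s y -> `|h k x - h k y| <= e].
Proof.
move=> Xunc; pose T := {F : set X | uncountable_closed F}.
have step (p : T * nat) : exists g : bool -> T,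
    [/\ forall b, sval (g b) `<=` sval p.1, sval (g true) `&` sval (g false) = set0 &
     forall k j, unpickle p.2 = Some (k, j) -> forall b x y, sval (g b) x -> sval (g b) y ->
       `|h k x - h k y| <= (j.+1%:R)^-1].
  case: p => [[F Fu] n] /=; have [F0 [F1 [F0u F1u F0F F1F F01]]] := uncountable_split Fu.
  (* Levels that code no pair need no particular step. *)
  pose kj := odflt (0, 0)%N (unpickle n).
  have j0 : 0 < (kj.2.+1%:R)^-1 :> R by rewrite invr_gt0.
  have [G0 G0u [G0F osc0]] := uncountable_shrink kj.1 j0 F0u.
  have [G1 G1u [G1F osc1]] := uncountable_shrink kj.1 j0 F1u.
  exists (fun b => if b then exist _ G0 G0u else exist _ G1 G1u); split=> [[]||] /=.
  - exact: subset_trans F0F.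
  - exact: subset_trans F1F.
  - by apply/seteqP; split=> // x [/G0F x0 /G1F x1]; rewrite -F01.
  - move=> k j kjE; have kjE' : kj = (k, j) by rewrite /kj kjE.
    by case=> x y /=; [move: (osc0 x y)|move: (osc1 x y)]; rewrite kjE'.
have [g gP] := choice step.
pose Xt : T := exist _ [set: X] (conj closedT Xunc).
pose F := fix F s : T := if s is b :: s' then g (F s', size s') b else Xt.
exists (fun s => sval (F s)); split.
- move=> s; case: (F s) => /= G [Gcl Gunc]; split=> //; apply/set0P/eqP => G0.
  by apply: Gunc; rewrite G0; exact: countable0.
- by move=> b s; have [+ _ _] := gP (F s, size s); exact.
- by move=> s; have [] := gP (F s, size s).
move=> k e e0; have [j je] : exists j, (j.+1%:R)^-1 <= e.
  have := archi_boundP (x := e^-1); set j := Num.bound _ => hj; exists j.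
  rewrite -[leRHS]invrK lef_pV2 ?posrE ?invr_gt0//; apply: ltW.
  by apply: lt_trans (hj _) _; rewrite ?invr_ge0 ?ltW// ltr_nat.
exists (pickle (k, j)).+1; elim=> //= b s IH; rewrite ltnS leq_eqVlt => /orP[/eqP sE|/IH].
  have [_ _ osc] := gP (F s, size s) => x y Fx Fy; apply: le_trans je.
  by apply: (osc k j _ b) => //=; rewrite -sE pickleK.
by move=> osc x y Fx Fy; apply: osc; have [+ _ _] := gP (F s, size s); apply; eauto.
Qed.

End CantorScheme.

(** A cluster point of points chosen in the successive sets lies in all of them. *)
Lemma nested_closed_point {X : topologicalType} (F : nat -> set X) :
    compact [set: X] -> (forall n, closed (F n)) -> (forall n, F n !=set0) ->
    (forall n, F n.+1 `<=` F n) -> exists x, forall n, F n x.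
Proof.
move=> Xc Fcl /choice[x Fx] Fdec.
have sub m n : (m <= n)%N -> F n `<=` F m.
  elim: n => [|n IH]; first by rewrite leqn0 => /eqP->.
  rewrite leq_eqVlt => /orP[/eqP->//|/IH]; exact: subset_trans.
have [|y [_ yc]] := Xc (x @ \oo) _; first exact: filterT.
exists y => n; have := yc; rewrite clusterE => /(_ (F n)).
have Fn : (x @ \oo) (F n) by exists n => // k /= /sub; apply.
by move=> /(_ Fn); rewrite -(closure_id _).1.
Qed.

(** * Coding points by binary words *)

(** The letters are numbered in order of appearance, and a word is continued by
    [false] beyond its length; [trunc] takes or pads accordingly. *)
Definition digit (s : seq bool) n : bool := nth false (rev s) n.

Definition trunc (n : nat) (s : seq bool) : seq bool :=
  rev (mkseq (digit s) n).

Lemma truncS n s : trunc n.+1 s = digit s n :: trunc n s.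
Proof. by rewrite /trunc mkseqS rev_rcons. Qed.

Lemma size_trunc n s : size (trunc n s) = n.
Proof. by rewrite size_rev size_mkseq. Qed.

Lemma digit_cons b s n : digit (b :: s) n =
  if (n < size s)%N then digit s n else if n == size s then b else false.
Proof. by rewrite /digit rev_cons nth_rcons size_rev. Qed.

Lemma digit_default s n : (size s <= n)%N -> digit s n = false.
Proof. by move=> sn; rewrite /digit nth_default// size_rev. Qed.

Lemma trunc_size s : trunc (size s) s = s.
Proof. by rewrite /trunc -(size_rev s) mkseq_nth revK. Qed.

Section CantorCoding.
Context {R : realType} {X : topologicalType}.
Variable F : seq bool -> set X.
Hypothesis F_closed : forall s, closed (F s).
Hypothesis F_neq0 : forall s, F s !=set0.
Hypothesis F_sub : forall b s, F (b :: s) `<=` F s.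
Hypothesis F_split : forall s, F (true :: s) `&` F (false :: s) = set0.
Hypothesis X_compact : compact [set: X].
Hypothesis X_hausdorff : hausdorff_space X.

Lemma scheme_points : exists p : seq bool -> X, forall s n, F (trunc n s) (p s).
Proof.
suff /choice[p pP] s : exists x, forall n, F (trunc n s) x by exists p.
apply: nested_closed_point => // n.
by rewrite truncS; exact: F_sub.
Qed.

Lemma scheme_disjoint s t x : size s = size t -> F s x -> F t x -> s = t.
Proof.
elim: s t => [|b s IH] [|c t]//= [st] Fs Ft.
have {IH}st' := IH t st (F_sub Fs) (F_sub Ft); rewrite st' in Fs *.
case: b c Fs Ft => -[]// Fs Ft; have := F_split t.
  by move/seteqP => -[/(_ x)]/(_ (conj Fs Ft)).
by move/seteqP => -[/(_ x)]/(_ (conj Ft Fs)).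
Qed.

(** The [n]-th digit separates two finite unions of closed sets of the scheme, which
    are disjoint, so Urysohn's lemma applies. *)
Lemma scheme_digits : exists u : nat -> X -> R,
  [/\ forall n, continuous (u n), forall n x, 0 <= u n x <= 1 &
      forall b s x, F (b :: s) x -> u (size s) x = b%:R].
Proof.
suff /choice[u uP] n : exists f : X -> R, [/\ continuous f, forall x, 0 <= f x <= 1 &
    forall b s x, size s = n -> F (b :: s) x -> f x = b%:R].
  exists u; split=> [n|n x|b s x Fx]; first by have [] := uP n.
    by have [_ + _] := uP n; apply.
  by have [_ _ +] := uP (size s); apply.
pose B b := \bigcup_(t in [set: n.-tuple bool]) F (b :: t).
have Bcl b : closed (B b).
  apply: closed_bigcup => [|t _]; [exact: finite_finset|exact: F_closed].
have B0 : B false `&` B true = set0.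
  apply/seteqP; split=> // x [[s _ Fs] [t _ Ft]].
  by have := scheme_disjoint _ Fs Ft; rewrite /= !size_tuple => /(_ erefl).
have us := normal_separatorP.1 (compact_normal X_hausdorff X_compact) _ _
  (Bcl false) (Bcl true) B0.
have [f [fc f01 f0 f1]] := (@uniform_separatorP X R _ _).1 (us R).
exists f; split=> // [x|b s x /eqP sn Fx].
  by have := f01 (f x) (ex_intro2 _ _ x I erefl); rewrite /= in_itv.
case: b Fx => Fx; [apply: f1|apply: f0]; exists x => //; by exists (Tuple sn).
Qed.

End CantorCoding.

(** * Angles with a finite binary expansion *)
Section Turn.
Context {R : realType}.
Implicit Types x y : R.

(** The point of the unit circle at [x] full turns. *)
Definition turn x : R[i] := (cos (2 * pi * x) +i* sin (2 * pi * x))%C.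

Lemma turnD x y : turn (x + y) = turn x * turn y.
Proof. by rewrite /turn mulrDr cosD sinD [in RHS]/GRing.mul/= [X in _ +i* X]addrC. Qed.

Lemma turn0 : turn 0 = 1. Proof. by rewrite /turn mulr0 cos0 sin0. Qed.

Lemma turn_half : turn (1 / 2) = -1.
Proof.
rewrite /turn (_ : 2 * pi * (1 / 2) = pi); last by field.
by rewrite cospi sinpi; apply/eqP; rewrite eq_complex/= oppr0 !eqxx.
Qed.

Lemma nm_turn x : nm (turn x) = 1.
Proof.
by apply/eqP; rewrite -(@eqrXn2 _ 2) ?nm_ge0// expr1n nm_sqr/= cos2Dsin2.
Qed.

Lemma turnX x n : turn x ^+ n = turn (n%:R * x).
Proof.
elim: n => [|n IH]; first by rewrite expr0 mul0r turn0.
by rewrite exprS IH -turnD -natr1 mulrDl mul1r addrC.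
Qed.

Lemma turn_nat n : turn n%:R = 1.
Proof.
have <- : turn (1 / 2) ^+ n.*2 = turn n%:R.
  by rewrite turnX -mul2n natrM; congr turn; field.
by rewrite turn_half -mul2n exprM sqrrN !expr1n.
Qed.

Lemma turn_bool_half (b : bool) : turn (b%:R / 2) = (-1) ^+ b.
Proof. by case: b; rewrite ?turn_half ?expr1// mul0r turn0. Qed.

Lemma turn_sin_ge0 x : 0 <= x <= 1 / 2 -> 0 <= Im (turn x).
Proof.
move=> /andP[x0 x1] /=; apply: sin_ge0_pi; have := pi_ge0 R; nra.
Qed.

Lemma turn_continuous : continuous (turn : R -> R[i]^o).
Proof.
apply: continuous_Complex => x.
- apply: continuous_comp; last exact: continuous_cos.
  by apply: cvgM; [exact: cvg_cst|exact: cvg_id].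
- apply: continuous_comp; last exact: continuous_sin.
  by apply: cvgM; [exact: cvg_cst|exact: cvg_id].
Qed.

Fixpoint dyadic (s : seq bool) : R :=
  if s is b :: s' then dyadic s' + b%:R / 2 ^+ (size s) else 0.

Lemma pow2_gt0 n : 0 < 2 ^+ n :> R. Proof. exact: exprn_gt0. Qed.

(** Multiplying the angle by [2 ^+ n] moves the first [n] digits into whole turns.
    The [n]-th digit then decides the half of the circle, and the digits after it
    give an angle [r] of at most half a turn.  For the induction the bound on [r]
    has to leave room for the digits still to come. *)
Lemma turn_digit n s : exists r, 0 <= r <= 1 / 2 /\
  turn (2 ^+ n * dyadic s) = (-1) ^+ digit s n * turn r.
Proof.
suff [r [r0 rs re]] : exists r, [/\ 0 <= r,
    if (size s <= n)%N then r = 0 else r <= 1 / 2 - 2 ^+ n / 2 ^+ size s &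
    turn (2 ^+ n * dyadic s) = (-1) ^+ digit s n * turn r].
  exists r; split=> //; rewrite r0 /=; move: rs; case: ifP => _; first by move=> ->; lra.
  move=> h; apply: le_trans h _; rewrite gerBl divr_ge0// ltW// pow2_gt0.
elim: s => [|b s [r [r0 rs re]]].
  by exists 0; split=> //; rewrite /digit nth_nil expr0 mulr0 turn0 mul1r.
have sn := pow2_gt0 (size s); have nn := pow2_gt0 n.
rewrite /= mulrDr turnD re digit_cons.
have [sn'|sn'|sn'] := ltngtP (size s) n.
- move: rs; rewrite (ltnW sn') => r00; exists 0; rewrite r00 turn0 !mulr1; split=> //.
  have -> : 2 ^+ n * (b%:R / 2 ^+ (size s).+1) = (b * 2 ^ (n - (size s).+1))%:R :> R.
    rewrite -{1}(subnK sn') exprD natrM natrX; field.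
    by rewrite expf_neq0.
  by rewrite turn_nat mulr1 digit_default// ltnW.
- move: rs; rewrite leqNgt sn'/= => rs.
  exists (r + 2 ^+ n * (b%:R / 2 ^+ (size s).+1)); split.
  + by apply: addr_ge0 => //; rewrite mulr_ge0 ?divr_ge0 ?ler0n// ltW// ?pow2_gt0.
  + rewrite exprS; move: rs; set D := _ ^+ n; set S := _ ^+ size s => rs.
    have -> : D * (b%:R / (2 * S)) = b%:R * (D / S) / 2 by field; rewrite gt_eqF.
    have -> : D / (2 * S) = D / S / 2 by field; rewrite gt_eqF.
    have DS : 0 < D / S by exact: divr_gt0.
    by case: (b); rewrite ?mul1r ?mul0r; lra.
  + by rewrite turnD [RHS]mulrA.
- move: rs; rewrite sn' leqnn => r00; exists 0; rewrite r00 turn0 !mulr1; split=> //.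
    rewrite (_ : 2 ^+ n / 2 ^+ n.+1 = 1 / 2) ?subrr// exprS; field.
    by rewrite gt_eqF.
  rewrite digit_default ?sn'// mul1r exprS.
  rewrite -turn_bool_half; congr turn; field.
  by rewrite gt_eqF.
Qed.

(** The mean of [f] over the [2 ^ N] words that continue [s] by [N] letters. *)
Fixpoint mean N (f : seq bool -> R[i]) (s : seq bool) : R[i] :=
  if N is N'.+1 then (mean N' f (false :: s) + mean N' f (true :: s)) / 2 else f s.

(** Each new letter multiplies the value by 1 or by a factor that depends on the
    position alone, so the mean is a product. *)
Lemma mean_turn (a : R) N s : mean N (fun t => turn (a * dyadic t)) s =
  turn (a * dyadic s) * \prod_(k < N) ((1 + turn (a / 2 ^+ (size s + k).+1)) / 2).
Proof.
elim: N s => [|N IH] s; first by rewrite big_ord0 mulr1.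
rewrite big_ord_recl /= !IH /= mul0r !addr0 addn0.
rewrite [X in _ = _ * (_ * X)](eq_bigr (fun k : 'I_N =>
  (1 + turn (a / 2 ^+ ((size s).+1 + k).+1)) / 2)); last first.
  by move=> k _; rewrite /bump/= addnS addSn.
rewrite mulrDr turnD mul1r mulrA; set P := \prod_(_ < _) _.
by set t := turn _; set t' := turn _; field.
Qed.

(** Write [n = 2 ^ v * m] with [m] odd: the factor at position [v] is
    [(1 + turn (m / 2)) / 2 = 0]. *)
Lemma mean_turn_eq0 n : (0 < n)%N -> exists n0, forall N, (n0 <= N)%N ->
  mean N (fun t => turn (n%:R * dyadic t)) [::] = 0.
Proof.
move=> n0; have [m cm nE] := pfactor_coprime (isT : prime 2) n0.
set v := logn 2 n in nE; exists v.+1 => N vN.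
rewrite mean_turn (bigD1 (Ordinal vN))//= add0n.
have -> : n%:R / 2 ^+ v.+1 = m./2%:R + 1 / 2 :> R.
  have mo : m = (m./2.*2).+1 by rewrite -[LHS]odd_double_half -coprime2n cm.
  rewrite {1}nE natrM natrX exprS {1}mo -addn1 natrD -mul2n natrM; field.
  by rewrite expf_neq0.
by rewrite turnD turn_nat turn_half mul1r subrr mul0r mul0r mulr0.
Qed.
End Turn.

(** * Sampling the algebra along a Cantor scheme *)
Section BinarySum.
Context {R : realType} {X : topologicalType}.
Variable u : nat -> X -> R.
Hypothesis u_cont : forall n, continuous (u n).
Hypothesis u01 : forall n x, 0 <= u n x <= 1.

Let S N x := \sum_(n < N) u n x / 2 ^+ n.+1.

(** The series [\sum_n u n / 2 ^+ n.+1] converges uniformly. *)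
Lemma exists_binary_sum : exists2 t : X -> R, continuous t &
  forall x N, S N x <= t x <= S N x + (1 / 2) ^+ N.
Proof.
have p2 n : 0 < 2 ^+ n :> R by exact: exprn_gt0.
have Smono x N k : S N x <= S (N + k) x.
  elim: k => [|k IH]; first by rewrite addn0.
  rewrite addnS; apply: le_trans IH _; rewrite /S big_ord_recr/= lerDl.
  by have /andP[? _] := u01 (N + k) x; rewrite divr_ge0// ltW.
have Stop x N k : S (N + k) x <= S N x + (1 / 2) ^+ N - (1 / 2) ^+ (N + k).
  elim: k => [|k IH]; first by rewrite addn0 addrK.
  rewrite addnS {1}/S big_ord_recr/= -/(S _ _).
  have h : u (N + k)%N x / 2 ^+ (N + k).+1 <= (1 / 2) ^+ (N + k).+1.
    by have /andP[_ ?] := u01 (N + k) x; rewrite expr_div_n expr1n ler_pM2r ?invr_gt0.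
  have hh : (1 / 2) ^+ (N + k) = 2 * (1 / 2) ^+ (N + k).+1 :> R by rewrite exprS; field.
  lra.
have Sle x N M : S M x <= S N x + (1 / 2) ^+ N.
  have e0 k : 0 <= (1 / 2) ^+ k :> R by apply: exprn_ge0; lra.
  have [MN|/ltnW NM] := leqP M N.
    by have := Smono x M (N - M)%N; rewrite subnKC//; have := e0 N; lra.
  by have := Stop x N (M - N)%N; rewrite subnKC//; have := e0 M; lra.
pose t x := sup (range (S ^~ x)).
have t_sup x : has_sup (range (S ^~ x)).
  by split; [exists (S 0 x); exists 0%N|exists (S 0 x + (1 / 2) ^+ 0) => _ [M _ <-]; exact: Sle].
have tS x N : S N x <= t x <= S N x + (1 / 2) ^+ N.
  apply/andP; split; first by apply: ub_le_sup; [case: (t_sup x)|exists N].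
  by apply: ge_sup => [|_ [M _ <-]]; [case: (t_sup x)|exact: Sle].
exists t => //; apply/continuousRP => x e e0.
have [||N /(_ N (leqnn N))] := @geometric_small R (1 / 2) 1 (e / 2).
  by apply/andP; split; lra.
  by lra.
rewrite mul1r => Ne.
have SNc : continuous (S N).
  rewrite /S; elim: (N) => [|k IH].
    have -> : (fun x => \sum_(n < 0) u n x / 2 ^+ n.+1) = fun=> 0.
      by apply/funext => y; rewrite big_ord0.
    exact: cst_continuous.
  have -> : (fun x => \sum_(n < k.+1) u n x / 2 ^+ n.+1) =
            (fun x => \sum_(n < k) u n x / 2 ^+ n.+1 + u k x / 2 ^+ k.+1).
    by apply/funext => y; rewrite big_ord_recr.
  by move=> y; apply: cvgD; [exact: IH|apply: cvgMl; exact: u_cont].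
have e2 : 0 < e / 2 by lra.
have := (continuousRP (S N)).1 SNc x _ e2; apply: filterS => y.
have /andP[? ?] := tS x N; have /andP[? ?] := tS y N.
by rewrite !ltr_norml => /andP[? ?]; lra.
Qed.

End BinarySum.

Lemma sum_digits (R : realType) s :
  \sum_(n < size s) (digit s n)%:R / 2 ^+ n.+1 = dyadic s :> R.
Proof.
elim: s => [|b s IH]; first by rewrite big_ord0.
rewrite [size (b :: s)]/= big_ord_recr/= digit_cons ltnn eqxx -IH; congr (_ + _).
by apply: eq_bigr => i _; rewrite digit_cons ltn_ord.
Qed.

Section Sampling.
Context {R : realType} {A : cstarAlgType R}.

(** [v a s] is the value of [a] at the point coded by the word [s].  The element [U n]
    reads the [n]-th digit and [w] is the angle with these digits;
    [sample_trunc] expresses uniform continuity along the scheme. *)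
Record dyadic_sampling (v : A -> seq bool -> R[i]) (U : nat -> A) (w : A) : Prop :=
  DyadicSampling {
  sample_lin : forall (k : R[i]) a b s, v (k *: a + b) s = k * v a s + v b s;
  sample_mul : forall a b s, v (a *c b) s = v a s * v b s;
  sample_one : forall s, v cone s = 1;
  sample_star : forall a s, v (cstar a) s = (v a s)^*;
  sample_le : forall a s, nm (v a s) <= nm a;
  sample_trunc : forall a (e : R), 0 < e -> exists n0, forall n s, (n0 <= n)%N ->
    nm (v a s - v a (trunc n s)) <= e;
  sample_digit : forall n s, v (U n) s = (digit s n)%:R;
  sample_turn : forall s, v w s = turn (dyadic s);
  sample_unitary : cstar w *c w = cone
}.

(** A dense sequence of [A] gives real functions that separate the points of [X], and
    a Cantor scheme on which they have vanishing oscillation.  Contractivity of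
    the characters transfers this to every element of [A], and the digit and angle
    functions belong to [A] because they are continuous. *)
Lemma exists_dyadic_sampling (X : topologicalType) :
  separable A -> is_spectrum A X -> ~ countable [set: X] ->
  exists v U w, dyadic_sampling v U w.
Proof.
move=> /separable_dense_seq[d dP] [Xc Xh [G [[Ginj Gran] Glin GM G1 Gstar]]] Xunc.
have Gcont a : continuous (G a).
  suff : [set f : X -> R[i]^o | continuous f] (G a) by [].
  by rewrite -Gran; exists a.
have Gsurj f : continuous f -> exists a, G a = f.
  by move=> fc; have : [set f : X -> R[i]^o | continuous f] f by []; rewrite -Gran => -[a _ <-]; exists a.
have Gle a x : nm (G a x : R[i]) <= nm a.
  by apply: (@character_contractive _ _ (fun a => G a x)).
have GB a b x : (G a x : R[i]) - G b x = G (a - b) x.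
  by rewrite [a - b]addrC -(scaleN1r b) Glin mulN1r addrC.
(* real and imaginary parts in alternation *)
pose h k x := if odd k then Im (G (d k./2) x : R[i]) else Re (G (d k./2) x : R[i]).
have h_cont k : continuous (h k).
  by rewrite /h; case: (odd k); [exact: continuous_Im|exact: continuous_Re].
have hE k : h k.*2 = fun x => Re (G (d k) x : R[i]).
  by apply/funext => x; rewrite /h odd_double doubleK.
have hO k : h k.*2.+1 = fun x => Im (G (d k) x : R[i]).
  by apply/funext => x; rewrite /h /= odd_double /= uphalf_double.
have h_sep x y : (forall k, h k x = h k y) -> x = y.
  move=> hxy; apply: contrapT => xy.
  have Gxy k : G (d k) x = G (d k) y.
    apply/eqP; rewrite eq_complex; apply/andP; split; apply/eqP.
      by have := hxy k.*2; rewrite hE.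
    by have := hxy k.*2.+1; rewrite hO.
  have cl (z : X) : closed [set z] by exact: (@accessible_closed_set1 _ (@hausdorff_accessible _ Xh) z).
  have xy0 : [set x] `&` [set y] = set0.
    by apply/seteqP; split=> // z [/= -> /xy].
  have us := normal_separatorP.1 (compact_normal Xh Xc) _ _ (cl x) (cl y) xy0.
  have [f [fc _ fx fy]] := (@uniform_separatorP X R [set x] [set y]).1 (us R).
  have [a aE] := Gsurj _ (continuous_real_complex fc).
  have e0 : 0 < 1 / 2 :> R by lra.
  have [k ak] := dP a _ e0.
  have fx0 : f x = 0 by apply: fx; exists x.
  have fy1 : f y = 1 by apply: fy; exists y.
  have h1 := le_lt_trans (Gle (a - d k) x) ak.
  have h2 := le_lt_trans (Gle (a - d k) y) ak.
  rewrite -!GB -Gxy in h1 h2.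
  have := nmBD (G a x : R[i]) (G (d k) x) (G a y).
  rewrite [nm (G (d k) x - _ : R[i])]nmC aE fx0 fy1.
  rewrite aE fx0 fy1 in h1 h2.
  rewrite -[X in nm X <= _ -> _]rmorphB/= nm_real sub0r normrN1; lra.
have [F [Fcn Fsub Fsplit Fosc]] := cantor_scheme h_cont h_sep Xunc.
have Fcl s : closed (F s) by case: (Fcn s).
have Fn0 s : F s !=set0 by case: (Fcn s).
have [p pF] := scheme_points Fcl Fn0 Fsub Xc.
have [u [uc u01 uF]] := @scheme_digits R _ F Fcl Fsub Fsplit Xc Xh.
have up n s : u n (p s) = (digit s n)%:R.
  have := pF s n.+1; rewrite truncS => /uF; by rewrite size_trunc.
have [t tc tS] := exists_binary_sum uc u01.
have tp s : t (p s) = dyadic s.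
  apply/eqP; rewrite -subr_eq0 -normr_eq0 eq_le normr_ge0 andbT.
  apply/ler_addgt0Pr => e e0; rewrite add0r.
  have [||N0 small] := @geometric_small R (1 / 2) 1 e; [by apply/andP; split; lra|by []|].
  pose N := (N0 + size s)%N; have := small N (leq_addr _ _); rewrite mul1r.
  have -> : dyadic s = \sum_(n < N) u n (p s) / 2 ^+ n.+1.
    rewrite -sum_digits /N addnC big_split_ord/= [X in _ = _ + X]big1 ?addr0.
      by apply: eq_bigr => i _; rewrite up.
    by move=> i _; rewrite up digit_default ?mul0r// leq_addr.
  by have /andP[? ?] := tS (p s) N => ?; rewrite ger0_norm; lra.
have /choice[U UE] n : exists a, G a = fun x => (u n x)%:C : R[i]^o.
  by apply: Gsurj; apply: continuous_real_complex; exact: uc.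
have [|w wE] := Gsurj (fun x => turn (t x) : R[i]^o).
  by move=> x; apply: continuous_comp; [exact: tc|exact: turn_continuous].
exists (fun a s => G a (p s)), U, w; split=> //.
- move=> a e e0; have e4 : 0 < e / 4 by lra.
  have [k ak] := dP a _ e4.
  have [n1 h1] := Fosc k.*2 _ e4; have [n2 h2] := Fosc k.*2.+1 _ e4.
  exists (maxn n1 n2) => n s; rewrite geq_max => /andP[nn1 nn2].
  have ps := pF s n; have pt : F (trunc n s) (p (trunc n s)).
    by have := pF (trunc n s) n; rewrite -{1}(size_trunc n s) trunc_size.
  have := h1 (trunc n s) ltac:(by rewrite size_trunc) _ _ ps pt.
  have := h2 (trunc n s) ltac:(by rewrite size_trunc) _ _ ps pt.
  rewrite hE hO -ImB -ReB => i1 r1.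
  have := nm_complex_le ((G (d k) (p s) : R[i]) - G (d k) (p (trunc n s))).
  have a1 := le_lt_trans (Gle (a - d k) (p s)) ak.
  have a2 := le_lt_trans (Gle (a - d k) (p (trunc n s))) ak.
  rewrite -!GB in a1 a2.
  have := nmBD (G a (p s) : R[i]) (G (d k) (p s)) (G a (p (trunc n s))).
  have := nmBD (G (d k) (p s) : R[i]) (G (d k) (p (trunc n s))) (G a (p (trunc n s))).
  rewrite [nm (G (d k) (p (trunc n s)) - _ : R[i])]nmC; lra.
- by move=> n s; rewrite UE up; case: (digit s n).
- by move=> s; rewrite wE tp.
apply: Ginj; apply/funext => x; rewrite GM Gstar G1 wE mulrC mulCJ nm_turn.
by rewrite expr1n.
Qed.

End Sampling.

(** * The mean along the binary tree *)
Section MeanLimit.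
Context {R : realType}.
Implicit Types (f g : seq bool -> R[i]) (s : seq bool).

Lemma meanD N f g s : mean N (fun t => f t + g t) s = mean N f s + mean N g s.
Proof. by elim: N s => //= N IH s; rewrite !IH; field. Qed.

Lemma meanZ N (k : R[i]) f s : mean N (fun t => k * f t) s = k * mean N f s.
Proof. by elim: N s => //= N IH s; rewrite !IH; field. Qed.

Lemma mean_conj N f s : mean N (fun t => (f t)^*) s = (mean N f s)^*.
Proof.
elim: N s => //= N IH s; rewrite !IH -rmorphD [RHS]rmorphM; congr (_ * _).
by rewrite fmorphV rmorph_nat.
Qed.

Lemma mean_cst N (k : R[i]) s : mean N (fun=> k) s = k.
Proof. by elim: N s => //= N IH s; rewrite !IH; field. Qed.

Lemma mean_ge0 N f s : (forall t, 0 <= f t) -> 0 <= mean N f s.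
Proof.
by move=> f0; elim: N s => //= N IH s; rewrite divr_ge0 ?addr_ge0 ?ler0n.
Qed.

Lemma mean_add M N f s : mean (M + N) f s = mean M (mean N f) s.
Proof. by elim: M s => //= M IH s; rewrite !IH. Qed.

Lemma mean_near M f g s (e : R) :
  (forall r, size r = M -> nm (f (r ++ s) - g (r ++ s)) <= e) ->
  nm (mean M f s - mean M g s) <= e.
Proof.
elim: M s => [|M IH] s h; first exact: (h [::]).
have half b : nm (mean M f (b :: s) - mean M g (b :: s)) <= e.
  by apply: IH => r rM; rewrite -cat_rcons; apply: h; rewrite size_rcons rM.
rewrite /= -mulrBl opprD addrACA nmM.
have -> : nm (2^-1 : R[i]) = 2^-1.
  by rewrite (_ : 2^-1 = (2^-1)%:C) ?nm_real ?ger0_norm ?invr_ge0// fmorphV rmorph_nat.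
have := nmD (mean M f (false :: s) - mean M g (false :: s)) (mean M f (true :: s) - mean M g (true :: s)).
have := half true; have := half false; lra.
Qed.

Lemma complex_tends (z : nat -> R[i]) :
    (forall e : R, 0 < e ->
       exists n0, forall m n, (n0 <= m)%N -> (n0 <= n)%N -> nm (z m - z n) < e) ->
  exists l, tends z l.
Proof.
move=> cz.
have real_lim (x : nat -> R) : (forall m n, `|x m - x n| <= nm (z m - z n)) ->
    exists l, forall e, 0 < e -> exists n0, forall n, (n0 <= n)%N -> `|x n - l| < e.
  move=> xz; have /cvg_ex[l xl] : cvg (x @ \oo).
    apply: cauchy_cvg; apply/cauchy_exP => e e0; have [n0 h] := cz e e0.
    exists (x n0); exists n0 => // n/= n0n.
    by rewrite -ball_normE/=; apply: le_lt_trans (xz _ _) _; exact: h.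
  exists l => e e0; have /cvgrPdist_lt/(_ e e0)[n0 _ h] := xl.
  by exists n0 => n /h; rewrite distrC.
have [|a ha] := real_lim (fun n => Re (z n)).
  by move=> m n; rewrite -ReB; exact: normRe_le.
have [|b hb] := real_lim (fun n => Im (z n)).
  by move=> m n; rewrite -ImB; exact: normIm_le.
exists (a +i* b)%C => e e0; have e2 : 0 < e / 2 by lra.
have [n1 h1] := ha _ e2; have [n2 h2] := hb _ e2.
exists (maxn n1 n2) => n; rewrite geq_max => /andP[/h1 {}h1 /h2 {}h2].
by have := nm_complex_le (z n - (a +i* b)%C); rewrite ReB ImB/=; lra.
Qed.

(** Beyond the level [n0] that controls the oscillation of [f], averaging over further
    letters changes the mean by at most [e / 4]. *)
Lemma mean_limit f :
    (forall e : R, 0 < e -> exists n0, forall n s, (n0 <= n)%N ->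
       nm (f s - f (trunc n s)) <= e) ->
  exists l, tends (fun N => mean N f [::]) l.
Proof.
move=> f_unif; apply: complex_tends => e e0; have e4 : 0 < e / 4 by lra.
have [n0 h] := f_unif _ e4; exists n0.
suff half m : (n0 <= m)%N -> nm (mean m f [::] - mean n0 f [::]) <= e / 4.
  move=> m n /half + /half; rewrite [nm (mean n f _ - _)]nmC.
  have := nmBD (mean m f [::]) (mean n0 f [::]) (mean n f [::]); lra.
move=> n0m; rewrite -(subnKC n0m) mean_add; apply: mean_near => t.
rewrite cats0 => tn; rewrite -[f t](mean_cst (m - n0)%N _ t).
apply: mean_near => r _; have := h n0 (r ++ t) (leqnn _).
suff -> : trunc n0 (r ++ t) = t by [].
have tr k : (k <= size t)%N -> trunc k (r ++ t) = trunc k t.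
  elim: r => //= b r IH kt; rewrite -IH// /trunc; congr rev.
  apply/eq_in_map => i; rewrite mem_iota/= add0n => ik.
  by rewrite digit_cons size_cat (leq_trans ik)// (leq_trans kt)// leq_addl.
by rewrite tr ?tn// -{1}tn trunc_size.
Qed.

End MeanLimit.

(** * Polynomials that approximate the sign *)
Section SignPolynomials.
Context {R : realType}.
Implicit Types x y z : R.

(** The iterates converge to the sign of [y] for [y] between -1 and 1, slowly near 0. *)
Definition sign_step y := (3 * y - y ^+ 3) / 2.

Lemma iter_sign_odd n z : iter n sign_step (- z) = - iter n sign_step z.
Proof. by elim: n => //= n ->; rewrite /sign_step; field. Qed.

Lemma bernoulli_inv x n : 0 <= x <= 1 -> (1 - x) ^+ n * (1 + n%:R * x) <= 1.
Proof.
move=> /andP[x0 x1]; elim: n => [|n IH]; first by rewrite expr0 mul0r addr0 mulr1.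
apply: le_trans IH; rewrite exprSr -mulrA; apply: ler_wpM2l.
  by apply: exprn_ge0; lra.
rewrite -natr1; have : 0 <= n%:R :> R by []. nra.
Qed.

Lemma iter_sign_bounds n z : 0 <= z <= 1 ->
  z <= iter n sign_step z <= 1 /\ 1 - iter n sign_step z <= (1 - z / 2) ^+ n.
Proof.
move=> /andP[z0 z1]; elim: n => [|n [/andP[IH1 IH2] IH3]].
  by rewrite lexx z1 expr0; split=> //=; lra.
rewrite iterS; set y := iter n _ z in IH1 IH2 IH3 *.
have y0 : 0 <= y by lra.
have e1 : 1 - sign_step y = (1 - y) * (1 - y) * (2 + y) / 2.
  by rewrite /sign_step; field.
have e2 : sign_step y - y = y * (1 - y) * (1 + y) / 2.
  by rewrite /sign_step; field.
split.
  apply/andP; split.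
    have : 0 <= y * (1 - y) * (1 + y) by rewrite !mulr_ge0//; lra.
    lra.
  have : 0 <= (1 - y) * (1 - y) * (2 + y) by rewrite !mulr_ge0//; lra.
  lra.
rewrite e1 exprSr; apply: le_trans (_ : (1 - y) * (1 - z / 2) <= _); last first.
  by apply: ler_wpM2r => //; lra.
rewrite -!mulrA; apply: ler_wpM2l; first lra.
nra.
Qed.

(** The defect [1 - iter n sign_step z] is at most [(1 - z / 2) ^+ n], which may stay near 1
    when [z] is small; multiplied by [z] it is uniformly of order [1 / n] by
    Bernoulli's inequality. *)
Lemma iter_sign_defect n z : 0 <= z <= 1 ->
  n.+1%:R * (z * (1 - iter n sign_step z)) <= 2.
Proof.
move=> z01; have /andP[z0 z1] := z01; have [_ h] := iter_sign_bounds n z01.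
have b := @bernoulli_inv (z / 2) n ltac:(by apply/andP; split; lra).
have q0 : 0 <= (1 - z / 2) ^+ n by apply: exprn_ge0; lra.
have h1 : n.+1%:R * (z * (1 - iter n sign_step z)) <= n.+1%:R * (z * (1 - z / 2) ^+ n).
  by rewrite ler_wpM2l ?ler0n// ler_wpM2l.
apply: le_trans h1 _; set q := _ ^+ n in b q0 *.
rewrite -natr1; have n0 : 0 <= n%:R :> R by [].
have : q * (z / 2) <= q by rewrite ler_piMr//; lra.
by move: b; rewrite mulrDr mulr1; lra.
Qed.

End SignPolynomials.

(** * Trigonometric polynomials *)
Section TrigPoly.
Context {R : realType} {A : cstarAlgType R}.
Hypothesis cmulC : commutative (cmul : A -> A -> A).
Variable w : A.
Implicit Types P Q : A.

Lemma trigpoly_monomial i j : trigpoly w (cstar (cpow w j) *c cpow w i).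
Proof. by rewrite -[_ *c _]scale1r -[_ *: _]addr0; apply/trigpolyD/trigpoly0. Qed.

Lemma trigpoly_add P Q : trigpoly w P -> trigpoly w Q -> trigpoly w (P + Q).
Proof.
by elim=> [|k i j {}P _ IH] hQ; rewrite ?add0r// -addrA; apply/trigpolyD/IH.
Qed.

Lemma trigpoly_scale (k : R[i]) P : trigpoly w P -> trigpoly w (k *: P).
Proof.
elim=> [|l i j {}P _ IH]; first by rewrite scaler0; exact: trigpoly0.
by rewrite scalerDr scalerA; exact: trigpolyD.
Qed.

Lemma trigpoly_sub P Q : trigpoly w P -> trigpoly w Q -> trigpoly w (P - Q).
Proof. by move=> hP hQ; rewrite -scaleN1r; apply/trigpoly_add/trigpoly_scale. Qed.

Lemma trigpoly_mul P Q : trigpoly w P -> trigpoly w Q -> trigpoly w (P *c Q).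
Proof.
move=> hP; elim=> [|k i j {}Q _ IH]; first by rewrite cmul0r; exact: trigpoly0.
rewrite cmul_linr; apply: trigpoly_add IH; apply: trigpoly_scale.
elim: hP => [|l i' j' {}P _ IH]; first by rewrite cmul0l; exact: trigpoly0.
rewrite cmul_linl; apply: trigpoly_add IH; apply: trigpoly_scale.
by rewrite cmulACA// -cstarM -!cpowD; exact: trigpoly_monomial.
Qed.

Lemma trigpoly_cpow i : trigpoly w (cpow w i).
Proof. by rewrite -[cpow w i]cmul1a -cstar1; exact: (trigpoly_monomial i 0). Qed.

Lemma trigpoly_one : trigpoly w cone. Proof. exact: (trigpoly_cpow 0). Qed.

Lemma trigpoly_cpow_star j : trigpoly w (cstar (cpow w j)).
Proof. by rewrite -[cstar _]cmula1; exact: (trigpoly_monomial 0 j). Qed.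

End TrigPoly.

(** * The state defined by the mean *)
Section SampledState.
Context {R : realType} {A : cstarAlgType R}.
Variables (v : A -> seq bool -> R[i]) (U : nat -> A) (w : A).
Hypothesis cmulC : commutative (cmul : A -> A -> A).
Hypothesis vU : dyadic_sampling v U w.

Lemma sample0 s : v 0 s = 0.
Proof. by have := sample_lin vU (-1) 0 0 s; rewrite scaler0 addr0 mulN1r addNr. Qed.
Lemma sampleZ (k : R[i]) a s : v (k *: a) s = k * v a s.
Proof. by rewrite -[k *: a]addr0 (sample_lin vU) sample0 addr0. Qed.
Lemma sampleD a b s : v (a + b) s = v a s + v b s.
Proof. by rewrite -[a]scale1r (sample_lin vU) mul1r scale1r. Qed.
Lemma sampleB a b s : v (a - b) s = v a s - v b s.
Proof. by rewrite -scaleN1r sampleD sampleZ mulN1r. Qed.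
Lemma sample_sum n (f : 'I_n -> A) s : v (\sum_(i < n) f i) s = \sum_(i < n) v (f i) s.
Proof. by apply: (big_morph (v^~ s)) => [a b|]; rewrite ?sampleD ?sample0. Qed.
Lemma sample_cpow a n s : v (cpow a n) s = v a s ^+ n.
Proof. by elim: n => [|n IH]; rewrite ?(sample_one vU)// (sample_mul vU) IH exprS. Qed.
Lemma sample_cpow_w n s : v (cpow w n) s = turn (n%:R * dyadic s).
Proof. by rewrite sample_cpow (sample_turn vU) turnX. Qed.
Lemma sample_sqr a s : v (cstar a *c a) s = (nm (v a s) ^+ 2)%:C.
Proof. by rewrite (sample_mul vU) (sample_star vU) mulrC mulCJ. Qed.

Lemma exists_mean_state : exists m : A -> R[i],
  forall a, tends (fun N => mean N (v a) [::]) (m a).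
Proof.
suff /choice[m mP] a : exists l, tends (fun N => mean N (v a) [::]) l by exists m.
by apply: mean_limit => e e0; have [n0 h] := sample_trunc vU a e0; exists n0.
Qed.

Variable m : A -> R[i].
Hypothesis mP : forall a, tends (fun N => mean N (v a) [::]) (m a).

Lemma state_moments : haar_moments w m.
Proof.
split=> [k a b|a|a|||n].
- apply: tends_unique (mP _) _.
  have -> : (fun N => mean N (v (k *: a + b)) [::]) =
      (fun N => k * mean N (v a) [::] + mean N (v b) [::]).
    apply/funext => N; rewrite -meanZ -meanD; congr (mean N _ _).
    by apply/funext => s; exact: (sample_lin vU).
  apply: tendsD (mP b).
  apply: (@tends_comp _ _ _ (fun z => k * z) (nm k) (fun N => mean N (v a) [::])) (mP a) => x y.
  by rewrite -mulrBr nmM.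
- apply: tends_unique (mP _) _.
  have -> : (fun N => mean N (v (cstar a)) [::]) = (fun N => (mean N (v a) [::])^*).
    apply/funext => N; rewrite -mean_conj; congr (mean N _ _).
    by apply/funext => s; exact: (sample_star vU).
  apply: (@tends_comp _ _ _ (fun z => z^*) 1 (fun N => mean N (v a) [::])) (mP a) => x y.
  by rewrite -rmorphB nmJ mul1r.
- apply: tends_ge0 (mP _) _ => N; apply: mean_ge0 => t.
  by rewrite sample_sqr ler0c sqr_ge0.
- exact: (sample_unitary vU).
- apply: tends_unique (mP _) _ => e e0; exists 0%N => N _.
  have -> : v cone = fun=> 1 by apply/funext => s; exact: (sample_one vU).
  by rewrite mean_cst subrr nm0.
- apply: tends_unique (mP _) _ => e e0; have [n0 h] := @mean_turn_eq0 R n.+1 isT.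
  exists n0 => N /h.
  have -> : v (cpow w n.+1) = fun t => turn (n.+1%:R * dyadic t).
    by apply/funext => s; exact: sample_cpow_w.
  by move=> ->; rewrite subrr nm0.
Qed.

Let mw := state_moments.

Lemma power_moments k : (0 < k)%N -> haar_moments (cpow w k) m.
Proof.
move=> k0; split; [exact: (haar_lin mw)|exact: (haar_conj mw)|exact: (haar_ge0 mw)| |exact: (haar_one mw)|].
  exact: (cpow_unitary mw).
have cpowM i : cpow (cpow w k) i = cpow w (k * i).
  by elim: i => [|i IH]; rewrite ?muln0// cpowS IH mulnS cpowD.
by move=> n; rewrite cpowM; case: (k) k0 => // k' _; exact: (haar_pow mw).
Qed.

(** The form in which pointwise estimates at the coded points are transferred to
    mean squares. *)
Lemma sqn_le3 a b1 b2 b3 (k1 k2 k3 : R) :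
    (forall s, nm (v a s) ^+ 2 <=
       k1 * nm (v b1 s) ^+ 2 + k2 * nm (v b2 s) ^+ 2 + k3 * nm (v b3 s) ^+ 2) ->
  sqn m a <= k1 * sqn m b1 + k2 * sqn m b2 + k3 * sqn m b3.
Proof.
move=> h; pose D := k1%:C *: (cstar b1 *c b1) + k2%:C *: (cstar b2 *c b2) +
   k3%:C *: (cstar b3 *c b3) + (-1)%:C *: (cstar a *c a).
have : 0 <= m D.
  apply: tends_ge0 (mP D) _ => N; apply: mean_ge0 => s.
  rewrite /D !sampleD !sampleZ !sample_sqr -!rmorphM -!rmorphD/= ler0c.
  by have := h s; lra.
move/ge0_Re; rewrite /D !(haarD mw) !(haarZ mw) !ReD !ReM_real -!/(sqn _ _); lra.
Qed.

Lemma sqn_one : sqn m cone = 1.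
Proof. by rewrite /sqn cmula1 cstar1 (haar_one mw). Qed.

Lemma state_bounded f (C : R) c : (forall s, nm (v f s) <= C) ->
  sqn m (f *c c) <= C ^+ 2 * sqn m c.
Proof.
move=> fC; have := @sqn_le3 (f *c c) c 0 0 (C ^+ 2) 0 0.
rewrite !mul0r !addr0; apply=> s; rewrite !mul0r !addr0 (sample_mul vU) nmM exprMn.
by apply: ler_wpM2r; [exact: sqr_ge0|rewrite ler_pXn2r// nnegrE ?(le_trans _ (fC s)) ?nm_ge0].
Qed.

End SampledState.

(** * Density of the trigonometric polynomials *)
Section Density.
Context {R : realType} {A : cstarAlgType R}.
Variables (v : A -> seq bool -> R[i]) (U : nat -> A) (w : A) (m : A -> R[i]).
Hypothesis cmulC : commutative (cmul : A -> A -> A).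
Hypothesis vU : dyadic_sampling v U w.
Hypothesis mP : forall a, tends (fun N => mean N (v a) [::]) (m a).

Let mw := state_moments vU mP.

(** The imaginary part of [w ^ (2 ^ n)], whose sign is given by the [n]-th digit. *)
Let sine n : A := (0 +i* (- (1 / 2)))%C *: (cpow w (2 ^ n) - cstar (cpow w (2 ^ n))).

Let sample_sine n s : v (sine n) s = (Im (turn (2 ^+ n * dyadic s)))%:C.
Proof.
rewrite /sine (sampleZ vU) (sampleB vU) (sample_star vU) (sample_cpow_w vU) natrX.
by apply/eqP; rewrite eq_complex/=; apply/andP; split; apply/eqP; field.
Qed.

Let step (a : A) : A := (3 / 2)%:C *: a + (- (1 / 2))%:C *: (a *c (a *c a)).

Let sample_step a s (y : R) : v a s = y%:C -> v (step a) s = (sign_step y)%:C.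
Proof.
move=> ay; rewrite /step (sampleD vU) !(sampleZ vU) !(sample_mul vU) ay.
by rewrite -!rmorphM -rmorphD/=; congr (_%:C); rewrite /sign_step; field.
Qed.

Let trigpoly_step a : trigpoly w a -> trigpoly w (step a).
Proof.
by move=> ha; apply: trigpoly_add; apply: trigpoly_scale => //;
  do 2 (apply: trigpoly_mul => //).
Qed.

(** The ergodic average of the rotation by the square of [w ^ (2 ^ n)].  It has mean square
    [1 / N], and it is close to 1 where [sine n] is close to 0. *)
Let average n N : A := cpoly (cpow w (2 ^ n.+1)) (fun=> (N%:R^-1)) N.

Let sqn_average n N : (0 < N)%N -> sqn m (average n N) = N%:R^-1.
Proof.
move=> N0; rewrite (sqn_cpoly (power_moments vU mP _)) ?expn_gt0//.
rewrite sumr_const card_ord.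
have -> : (N%:R^-1 : R[i]) = (N%:R^-1)%:C by rewrite fmorphV rmorph_nat.
rewrite nm_real ger0_norm ?invr_ge0 ?ler0n// -[LHS]mulr_natl expr2 mulrA divff ?mul1r//.
by rewrite pnatr_eq0 -lt0n.
Qed.

Let average_near n N s (z : R) : (0 < N)%N ->
  nm (1 - turn (2 ^+ n.+1 * dyadic s)) <= z ->
  nm (1 - v (average n N) s) <= N%:R * z.
Proof.
move=> N0; set Z := turn _ => hz.
have Z1 : nm Z = 1 by exact: nm_turn.
have pow i : nm (1 - Z ^+ i) <= i%:R * z.
  elim: i => [|i IH]; first by rewrite expr0 subrr nm0 mul0r.
  have -> : 1 - Z ^+ i.+1 = (1 - Z ^+ i) + Z ^+ i * (1 - Z) by rewrite exprSr; ring.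
  apply: le_trans (nmD _ _) _; rewrite nmM nmX Z1 expr1n mul1r -natr1 mulrDl mul1r.
  exact: lerD.
have n0 : N%:R != 0 :> R[i] by rewrite pnatr_eq0 -lt0n.
have -> : 1 - v (average n N) s = \sum_(i < N) N%:R^-1 * (1 - Z ^+ i).
  rewrite /average /cpoly (sample_sum vU) -mulr_sumr sumrB sumr_const card_ord.
  rewrite mulrBr -[1 *+ N]/(N%:R) mulVf// mulr_sumr; congr (_ - _).
  apply: eq_bigr => i _; rewrite (sampleZ vU) (sample_cpow vU) (sample_cpow_w vU).
  by rewrite natrX.
have z0 : 0 <= z by apply: le_trans hz; exact: nm_ge0.
have nN : nm (N%:R^-1 : R[i]) = N%:R^-1.
  by rewrite (_ : N%:R^-1 = (N%:R^-1)%:C) ?nm_real ?ger0_norm ?invr_ge0// fmorphV rmorph_nat.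
apply: le_trans (_ : \sum_(i < N) (z : R) <= _); last first.
  by rewrite sumr_const card_ord mulr_natl.
elim/big_rec2: _ => [|i y1 y2 _ h]; first by rewrite nm0.
apply: le_trans (nmD _ _) _; apply: lerD => //; rewrite nmM nN.
rewrite mulrC ler_pdivrMr ?ltr0n// mulrC; apply: le_trans (pow i) _.
by apply: ler_wpM2r => //; rewrite ler_nat ltnW.
Qed.

Let archi (x : R) : exists j, x <= j.+1%:R.
Proof.
exists (Num.bound `|x|); apply: le_trans (ler_norm x) _; apply: ltW.
by apply: lt_trans (archi_boundP (normr_ge0 x)) _; rewrite ltr_nat.
Qed.

Let nm_1subsqr (z : R[i]) : nm z = 1 -> nm (1 - z ^+ 2) <= 2 * `|Im z|.
Proof.
move=> z1; have -> : 1 - z ^+ 2 = z * (z^* - z).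
  by rewrite mulrBr mulCJ z1 expr1n expr2.
rewrite nmM z1 mul1r; apply: le_trans (nm_complex_le _) _.
case: z {z1} => a b /=; rewrite subrr normr0 add0r -opprD normrN.
by rewrite -mulr2n normrMn mulr_natl.
Qed.

(** The sign polynomials at [sine n] approximate the [n]-th digit except where
    [sine n] is small.  There [average n N] is close to 1, so that set carries a
    mass of at most order [1 / N]: with [d] the defect of the approximation,
    [d <= |average| + d |1 - average|], and the last term is at most a multiple of
    [N d |sine|], which is of order [N / j] for the [j]-th iterate. *)
Lemma digit_approx n (e : R) : 0 < e -> exists b, [/\ trigpoly w b,
  forall s, exists2 y : R, 0 <= y <= 1 & v b s = y%:C & sqn m (U n - b) <= e].
Proof.
move=> e0; have [N' Ne] := archi e^-1; set N := N'.+1 in Ne.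
have mine : 0 < Num.min 1 e by rewrite lt_min ltr01.
have [j je] := archi (4 * N%:R / Num.min 1 e).
(* the bound on the defect times the distance of the average from 1 *)
pose k : R := 4 * N%:R / j.+1%:R.
have j0 : 0 < j.+1%:R :> R by rewrite ltr0n.
have N0 : 0 < N%:R :> R by rewrite ltr0n.
have k0 : 0 <= k by apply: divr_ge0; [apply: mulr_ge0|].
have kk : k ^+ 2 <= e.
  have kmin : k <= Num.min 1 e by rewrite /k ler_pdivrMr// [leRHS]mulrC -ler_pdivrMr.
  move: kmin; rewrite le_min => /andP[k1 ke]; apply: le_trans ke.
  by rewrite expr2 ler_piMr.
have Ninv : N%:R^-1 <= e by rewrite -[e]invrK lef_pV2 ?posrE ?invr_gt0.
pose b := (1 / 2)%:C *: (cone - iter j step (sine n)).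
have trig_sine : trigpoly w (sine n).
  by apply: trigpoly_scale; apply: trigpoly_sub;
    [exact: trigpoly_cpow|exact: trigpoly_cpow_star].
have b_trig : trigpoly w b.
  apply: trigpoly_scale; apply: trigpoly_sub; first exact: trigpoly_one.
  by elim: (j) => //= i; exact: trigpoly_step.
pose y s : R := Im (turn (2 ^+ n * dyadic s)).
have bE s : v b s = ((1 - iter j sign_step (y s)) / 2)%:C.
  have iterE i : v (iter i step (sine n)) s = (iter i sign_step (y s))%:C.
    by elim: i => [|i IH] /=; [exact: sample_sine|exact: sample_step].
  rewrite /b (sampleZ vU) (sampleB vU) (sample_one vU) iterE.
  by apply/eqP; rewrite eq_complex/=; apply/andP; split; apply/eqP; field.
have key s : exists z q : R, [/\ 0 <= z <= 1, 0 <= q <= 1, j.+1%:R * (z * (1 - q)) <= 2,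
    iter j sign_step (y s) = (if digit s n then - q else q) &
    nm (1 - turn (2 ^+ n.+1 * dyadic s)) <= 2 * z].
  have [r [r01 rE]] := @turn_digit R n s.
  have z0 := turn_sin_ge0 r01; have z1 := normIm_le (turn r).
  rewrite nm_turn ger0_norm// in z1.
  have z01 : 0 <= Im (turn r) <= 1 by apply/andP.
  have [/andP[q0 q1] _] := iter_sign_bounds j z01.
  exists (Im (turn r)), (iter j sign_step (Im (turn r))); split=> //.
  - by apply/andP; split=> //; exact: le_trans q0.
  - exact: iter_sign_defect.
  - rewrite /y rE; case: (digit s n); last by rewrite expr0 mul1r.
    have -> : Im ((-1) ^+ true * turn r) = - Im (turn r).
      by rewrite expr1 mulN1r; exact: raddfN.
    exact: iter_sign_odd.
  - have -> : turn (2 ^+ n.+1 * dyadic s) = turn r ^+ 2.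
      have -> : turn (2 ^+ n.+1 * dyadic s : R) = turn (2 ^+ n * dyadic s) ^+ 2.
        by rewrite (turnX (2 ^+ n * dyadic s) 2) mulrA -exprS.
      by rewrite rE exprMn -exprM mulnC exprM sqrrN !expr1n mul1r.
    by rewrite -[X in _ <= 2 * X]ger0_norm//; apply: nm_1subsqr; exact: nm_turn.
exists b; split=> // [s|].
  have [z [q [_ /andP[q0 q1] _ qE _]]] := key s.
  exists ((1 - iter j sign_step (y s)) / 2); last exact: bE.
  by rewrite qE; case: ifP => _; lra.
have := @sqn_le3 _ _ v U w vU m mP (U n - b) (average n N) cone 0 (1 / 2) (k ^+ 2 / 2) 0.
rewrite mul0r addr0 (sqn_one vU mP) sqn_average// mulr1 => h; apply: le_trans (h _) _; last lra.
move=> s; rewrite mul0r addr0 (sample_one vU) nm1 expr1n mulr1.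
have [z [q [/andP[z0 z1] /andP[q0 q1] zq qE hz]]] := key s.
have nA := average_near (N := N) isT hz.
have -> : nm (v (U n - b) s) ^+ 2 = ((1 - q) / 2) ^+ 2.
  rewrite (sampleB vU) (sample_digit vU) bE qE.
  case: (digit s n); rewrite -?[1%:R]/(1%:C) -?[0%:R]/(0%:C) -rmorphB nm_real real_normK ?num_real//.
    by congr (_ ^+ 2); field.
  by rewrite -sqrrN; congr (_ ^+ 2); field.
set a := nm (v (average n N) s).
have a1 : 1 <= a + nm (1 - v (average n N) s).
  have := nmD (v (average n N) s) (1 - v (average n N) s).
  by rewrite addrC subrK nm1.
have d0 : 0 <= 1 - q by lra.
have a0 : 0 <= a by exact: nm_ge0.
have dk : (1 - q) * (N%:R * (2 * z)) <= k.
  rewrite /k ler_pdivlMr//.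
  have -> : (1 - q) * (N%:R * (2 * z)) * j.+1%:R = 2 * N%:R * (j.+1%:R * (z * (1 - q))).
    by ring.
  have -> : 4 * N%:R = 2 * N%:R * 2 :> R by ring.
  by apply: ler_wpM2l => //; rewrite mulr_ge0 ?ltW.
have dak : 1 - q <= a + k.
  have : (1 - q) * 1 <= (1 - q) * (a + N%:R * (2 * z)).
    by apply: ler_wpM2l => //; lra.
  have : (1 - q) * a <= a by rewrite ler_piMl//; lra.
  rewrite mulr1 mulrDr; lra.
have : (1 - q) ^+ 2 <= (a + k) ^+ 2 by rewrite ler_pXn2r// nnegrE; lra.
have := sqr_ge0 (a - k); rewrite !expr2; lra.
Qed.

Definition trig_limit (C : R) f : Prop := forall e : R, 0 < e -> exists P,
  [/\ trigpoly w P, sqn m (f - P) <= e & forall s, nm (v P s) <= C].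

(** Replace the digit [U n] by an approximant [b] with values between 0 and 1.  The bound
    [C] survives since [(1 - b) P0 + b P1] is a convex combination at each point. *)
Lemma trig_limit_mix C n f0 f1 : 0 <= C -> trig_limit C f0 -> trig_limit C f1 ->
  trig_limit C ((cone - U n) *c f0 + U n *c f1).
Proof.
move=> C0 lim0 lim1 e e0.
(* The three errors enter the estimate with weights 3, 3 and [12 * C ^+ 2]. *)
pose d := e / (6 + 12 * C ^+ 2).
have C2 := sqr_ge0 C.
have d0 : 0 < d by apply: divr_gt0 => //; lra.
have [P0 [trig0 near0 le0]] := lim0 d d0; have [P1 [trig1 near1 le1]] := lim1 d d0.
have [b [trigb b01 nearb]] := digit_approx n d0.
exists ((cone - b) *c P0 + b *c P1); split.
- apply: trigpoly_add; apply: trigpoly_mul => //.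
  by apply: trigpoly_sub => //; exact: trigpoly_one.
- have := @sqn_le3 _ _ v U w vU m mP ((cone - U n) *c f0 + U n *c f1 - ((cone - b) *c P0 + b *c P1))
    (f0 - P0) (f1 - P1) (U n - b) 3 3 (12 * C ^+ 2).
  move=> h; apply: le_trans (h _) _; last first.
    have -> : e = (6 + 12 * C ^+ 2) * d by rewrite /d; field; lra.
    have : 12 * C ^+ 2 * sqn m (U n - b) <= 12 * C ^+ 2 * d.
      by apply: ler_wpM2l => //; lra.
    lra.
  move=> s.
  have -> : v ((cone - U n) *c f0 + U n *c f1 - ((cone - b) *c P0 + b *c P1)) s =
     (1 - v (U n) s) * v (f0 - P0) s + v (U n) s * v (f1 - P1) s +
     v (U n - b) s * (v P1 s - v P0 s).
    rewrite !(sampleB vU) !(sampleD vU) !(sample_mul vU) !(sampleB vU) (sample_one vU).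
    by ring.
  set x0 := v (f0 - P0) s; set x1 := v (f1 - P1) s; set x2 := v (U n - b) s.
  have t : nm ((1 - v (U n) s) * x0 + v (U n) s * x1) <= nm x0 + nm x1.
    have := nm_ge0 x0; have := nm_ge0 x1.
    rewrite (sample_digit vU); case: (digit s n) => /=.
      by rewrite subrr mul0r mul1r add0r; lra.
    by rewrite subr0 mul0r mul1r addr0; lra.
  have t2 : nm (x2 * (v P1 s - v P0 s)) <= nm x2 * (2 * C).
    rewrite nmM; apply: ler_wpM2l; first exact: nm_ge0.
    by have := nmD (v P1 s) (- v P0 s); rewrite nmN; have := le0 s; have := le1 s; lra.
  have t3 := nmD ((1 - v (U n) s) * x0 + v (U n) s * x1) (x2 * (v P1 s - v P0 s)).
  set X := nm (_ + _ * _) in t3 *.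
  have : X ^+ 2 <= (nm x0 + nm x1 + nm x2 * (2 * C)) ^+ 2.
    by rewrite ler_pXn2r// ?nnegrE ?nm_ge0 ?addr_ge0 ?mulr_ge0 ?nm_ge0//; lra.
  have := sqr_ge0 (nm x0 - nm x1); have := sqr_ge0 (nm x0 - nm x2 * (2 * C)).
  have := sqr_ge0 (nm x1 - nm x2 * (2 * C)); rewrite !expr2; lra.
move=> s; have [y /andP[y0 y1] by_] := b01 s.
rewrite (sampleD vU) !(sample_mul vU) (sampleB vU) (sample_one vU) by_.
apply: le_trans (nmD _ _) _; rewrite -rmorphB !nmM !nm_real !ger0_norm//; last lra.
have : (1 - y) * nm (v P0 s) <= (1 - y) * C by apply: ler_wpM2l; [lra|exact: le0].
have : y * nm (v P1 s) <= y * C by apply: ler_wpM2l.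
lra.
Qed.

(** The function that reads [k] digits after [s] and returns the value of [f] at the
    point coded by the word obtained. *)
Fixpoint cylinder_fun f k s : A :=
  if k is k'.+1 then (cone - U (size s)) *c cylinder_fun f k' (false :: s) +
    U (size s) *c cylinder_fun f k' (true :: s)
  else v f s *: cone.

Lemma cylinder_fun_limit f k s : trig_limit (nm f) (cylinder_fun f k s).
Proof.
elim: k s => [|k IH] s /=; last exact: trig_limit_mix (nm_ge0 _) (IH _) (IH _).
move=> e e0; exists (v f s *: cone); split.
- exact/trigpoly_scale/trigpoly_one.
- by rewrite subrr /sqn cmul0r (haar0 mw)/= ltW.
- by move=> t; rewrite (sampleZ vU) (sample_one vU) mulr1; exact: (sample_le vU).
Qed.

Lemma sample_cylinder_fun f k s t : trunc (size s) t = s ->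
  v (cylinder_fun f k s) t = v f (trunc (size s + k) t).
Proof.
elim: k s => [|k IH] s ts.
  by rewrite addn0 ts /= (sampleZ vU) (sample_one vU) mulr1.
rewrite /= (sampleD vU) !(sample_mul vU) (sampleB vU) (sample_one vU) (sample_digit vU).
have := truncS (size s) t; rewrite ts => tS; rewrite -addSnnS.
case: (digit t (size s)) tS => /= tS.
  by rewrite subrr mul0r add0r mul1r (IH (true :: s) tS).
by rewrite subr0 mul0r addr0 mul1r (IH (false :: s) tS).
Qed.

(** An element [f] differs little from [cylinder_fun f n0 [::]] at the coded points, and
    the latter is a mean-square limit of trigonometric polynomials bounded by the
    norm of [f]. *)
Theorem haar_functional_of_sampling : haar_functional w m.
Proof.
split=> [|f|f]; first exact: mw.
  exists (nm f ^+ 2) => [|c]; first exact: sqr_ge0.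
  by apply: (state_bounded vU mP) => s; exact: (sample_le vU).
exists (nm f ^+ 2) => [|e e0]; first exact: sqr_ge0.
have [d d0 de] : exists2 d : R, 0 < d & d ^+ 2 <= e / 4.
  exists (Num.min 1 (e / 4)); first by rewrite lt_min ltr01/=; lra.
  have : Num.min 1 (e / 4) <= 1 by rewrite ge_min lexx.
  have : Num.min 1 (e / 4) <= e / 4 by rewrite ge_min lexx orbT.
  have : 0 < Num.min 1 (e / 4) by rewrite lt_min ltr01/=; lra.
  set x := Num.min _ _ => *; rewrite expr2; nra.
have [n0 fd] := sample_trunc vU f d0.
pose g := cylinder_fun f n0 [::].
have gE t : v g t = v f (trunc n0 t).
  by rewrite /g sample_cylinder_fun ?add0n//; apply: size0nil; rewrite size_trunc.
have e4 : 0 < e / 4 by lra.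
have [P [Ptrig gP PC]] := @cylinder_fun_limit f n0 [::] _ e4.
exists P; split=> // [|c]; last exact: (state_bounded vU mP).
have fg : sqn m (f - g) <= d ^+ 2.
  have := @sqn_le3 _ _ v U w vU m mP (f - g) cone 0 0 (d ^+ 2) 0 0.
  rewrite !mul0r !addr0 (sqn_one vU mP) mulr1; apply=> t.
  rewrite !mul0r !addr0 (sample_one vU) nm1 expr1n mulr1 (sampleB vU) gE.
  by rewrite ler_pXn2r// ?nnegrE ?nm_ge0 ?(ltW d0)//; exact: fd.
have := sqnD_le mw (f - g) (g - P); rewrite subrKA; rewrite -/g in gP; lra.
Qed.

End Density.

Theorem theorem7p10 (R : realType) (A : cstarAlgType R) (X : topologicalType)
    (H : hilbertType R)
    (A_commutative : commutative (cmul : A -> A -> A))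
    (A_separable : separable A)
    (A_spectrum : is_spectrum A X)
    (X_uncountable : ~ countable [set: X])
    (H_infinite : ~ finite_dimensional H)
    (H_separable : separable H) :
  exists2 phi : A -> boundedOp H, cstar_extreme phi & ~ star_homomorphism phi.
Proof.
have [v [U [w vU]]] := exists_dyadic_sampling A_separable A_spectrum X_uncountable.
have [m mP] := exists_mean_state vU.
have mw := haar_functional_of_sampling A_commutative vU mP.
have [e e_onb] := exists_orthonormal_basis H_separable H_infinite.
have [phi phiP] := exists_toeplitz_map mw e_onb.
exists phi; first exact: (toeplitz_cstar_extreme A_commutative mw e_onb phiP).
exact: (toeplitz_not_hom A_commutative mw e_onb phiP).
Qed.
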